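(* Let $k$ be a field, let $P$ be either $\mathbb{R}$, $\mathbb{R}^2$, or a finite poset, and let $\mathcal{D}$ be the category of finitely presentable $k$-representations of $P$. Then $\mathrm{dgm}^{\mathrm{Int}}$ is the unique additive invariant on $\mathcal{D}$ that is equivalent to the generalized rank invariant $\mathrm{rk}^{\mathrm{Int}}$ and fixes intervals. That is, $\mathrm{dgm}^{\mathrm{Int}}: K_0^{sp}(\mathcal{D})\to K_0^{sp}(\mathcal{C})$ is a group homomorphism with $\ker \mathrm{dgm}^{\mathrm{Int}}=\ker\mathrm{rk}^{\mathrm{Int}}$ and $\mathrm{dgm}^{\mathrm{Int}}(c)=c$ for all $c\in K_0^{sp}(\mathcal{C})$, and any group homomorphism $f: K_0^{sp}(\mathcal{D})\to K_0^{sp}(\mathcal{C})$ with $\ker f=\ker \mathrm{rk}^{\mathrm{Int}}$ and $f(c)=c$ for all $c\in K_0^{sp}(\mathcal{C})$ equals $\mathrm{dgm}^{\mathrm{Int}}$. Here $\mathcal{C}$ is the full subcategory of $\mathcal{D}$ of finite direct sums of finitely presentable interval representations.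
   Context: A $k$-representation of a poset $P$ is a functor from $P$ (viewed as a category with a unique morphism $x\to y$ iff $x\le y$) to $k$-vector spaces. $\mathbb{R}^2$ carries the product order. A full subposet $I\subseteq P$ is an interval if it is nonempty, connected (any two of its points are joined by a sequence of points of $I$ in which consecutive points are comparable) and convex ($x\le y\le z$ with $x,z\in I$ implies $y\in I$). $\mathrm{Int}(P)$ is the set of intervals. The interval representation $k_I$ has $k_I(x)=k$ for $x\in I$ and $0$ otherwise, with identity maps between points $x\le y$ of $I$ and zero maps otherwise. A representation is finitely presentable if it is isomorphic to the cokernel of a morphism between finite direct sums of representations $k_{x^\uparrow}$, where $x^\uparrow=\{y\in P: x\le y\}$. The category $\mathcal{D}$ of finitely presentable representations is Krull-Schmidt, and its objects are pointwise finite-dimensional. $\mathrm{int}(P)=\{I\in\mathrm{Int}(P): k_I \text{ finitely presentable}\}$. The split Grothendieck group $K_0^{sp}(\mathcal{D})$ is the free abelian group on isomorphism classes $[M]$ of objects of $\mathcal{D}$ modulo $[M\oplus N]=[M]+[N]$; it is free on the isomorphism classes of indecomposables. $K_0^{sp}(\mathcal{C})$ is the subgroup with basis $\{[k_I]: I\in\mathrm{int}(P)\}$, and is identified with the group of finitely supported functions $\mathrm{int}(P)\to\mathbb{Z}$, and thus (extending by zero) with a subgroup of $\mathbb{Z}^{\mathrm{Int}(P)}$. An additive invariant on $\mathcal{D}$ is a group homomorphism from $K_0^{sp}(\mathcal{D})$ to an abelian group; two additive invariants are equivalent if they have equal kernels. The generalized rank invariant $\mathrm{rk}^{\mathrm{Int}}: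 K_0^{sp}(\mathcal{D})\to\mathbb{Z}^{\mathrm{Int}(P)}$ is the additive invariant sending $[M]$ to the function $I\mapsto$ rank of the canonical linear map $\varprojlim M|_I\to\varinjlim M|_I$. The generalized persistence diagram: for $M\in\mathcal{D}$, $\mathrm{dgm}^{\mathrm{Int}}([M])$ is the unique function $d:\mathrm{Int}(P)\to\mathbb{Z}$ such that for every $I\in\mathrm{Int}(P)$ only finitely many intervals $J\supseteq I$ satisfy $d(J)\ne0$, and $\mathrm{rk}^{\mathrm{Int}}([M])(I)=\sum_{J\in\mathrm{Int}(P),\,J\supseteq I}d(J)$. It is known that for the posets $P$ in question such $d$ exists for every $M\in\mathcal{D}$ and is finitely supported, with support in $\mathrm{int}(P)$, so it is viewed as an element of $K_0^{sp}(\mathcal{C})$; and $\mathrm{dgm}^{\mathrm{Int}}$ is then extended to all of $K_0^{sp}(\mathcal{D})$ by $\mathrm{dgm}^{\mathrm{Int}}([M]-[N])=\mathrm{dgm}^{\mathrm{Int}}([M])-\mathrm{dgm}^{\mathrm{Int}}([N])$. *)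

(* Defs.v *)
From HB Require Import structures.
From mathcomp Require Import all_boot all_order all_algebra.
From mathcomp Require Import all_classical all_reals.
From mathcomp Require Import freeg.

Set Implicit Arguments.
Unset Strict Implicit.
Unset Printing Implicit Defensive.

Import Order.TTheory GRing.Theory Num.Theory.

Local Open Scope classical_set_scope.
Local Open Scope quotient_scope.
Local Open Scope ring_scope.

Definition zspan (V : zmodType) (A : set V) : {pred V} :=
  [pred v | `[< forall S : {pred V}, zmod_closed S ->
                  (forall a, A a -> a \in S) -> v \in S >]].

Lemma zspan_closed (V : zmodType) (A : set V) : zmod_closed (zspan A).
Proof.
split=> [|u v /asboolP Hu /asboolP Hv]; apply/asboolP => S SP SA.
  by case: SP.
by case: (SP) => _; apply; [exact: Hu | exact: Hv].
Qed.

HB.instance Definition _ (V : zmodType) (A : set V) :=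
  GRing.isZmodClosed.Build V (zspan A) (zspan_closed A).

Definition lspan (R : pzRingType) (V : lmodType R) (A : set V) : {pred V} :=
  [pred v | `[< forall S : {pred V}, submod_closed S ->
                  (forall a, A a -> a \in S) -> v \in S >]].

Lemma lspan_closed (R : pzRingType) (V : lmodType R) (A : set V) :
  submod_closed (lspan A).
Proof.
split=> [|a u v /asboolP Hu /asboolP Hv]; apply/asboolP => S SP SA.
  by case: SP.
by case: (SP) => _; apply; [exact: Hu | exact: Hv].
Qed.

HB.instance Definition _ (R : pzRingType) (V : lmodType R) (A : set V) :=
  GRing.isSubmodClosed.Build R V (lspan A) (lspan_closed A).

(** The quotient by the submodule generated by [A]. The library's
    [{ideal_quot S}] is the quotient of a Z-module by any subgroup [S]. *)
Section QuotientModule.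
Context (R : pzRingType) (V : lmodType R) (A : set V).

Local Notation S := (lspan A).

Definition lquot : Type := {ideal_quot S}.

HB.instance Definition _ := GRing.Zmodule.on lquot.

Definition lquot_pi (v : V) : lquot := \pi_{ideal_quot S} v.

Definition lquot_scale (a : R) (q : lquot) : lquot :=
  lquot_pi (a *: repr (q : {ideal_quot S})).

Lemma lquot_piP (u v : V) : lquot_pi u = lquot_pi v <-> u - v \in S.
Proof.
by rewrite Quotient.idealrBE; split=> [/eqP|/eqP].
Qed.

Lemma lquot_piD (u v : V) : lquot_pi (u + v) = lquot_pi u + lquot_pi v.
Proof. exact: Quotient.pi_add. Qed.

Lemma lquot_reprK (q : lquot) : lquot_pi (repr (q : {ideal_quot S})) = q.
Proof. exact: reprK. Qed.

Lemma lquot_piZ (a : R) (v : V) : lquot_pi (a *: v) = lquot_scale a (lquot_pi v).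
Proof.
apply/lquot_piP; rewrite -scalerBr rpredZ//.
by apply/lquot_piP; rewrite lquot_reprK.
Qed.

Fact lquot_scaleA a b q :
  lquot_scale a (lquot_scale b q) = lquot_scale (a * b) q.
Proof. by rewrite -(lquot_reprK q) -!lquot_piZ scalerA. Qed.

Fact lquot_scale1 : left_id 1 lquot_scale.
Proof. by move=> q; rewrite -(lquot_reprK q) -lquot_piZ scale1r. Qed.

Fact lquot_scaleDr : right_distributive lquot_scale +%R.
Proof.
move=> a p q; rewrite -(lquot_reprK p) -(lquot_reprK q).
by rewrite -lquot_piD -!lquot_piZ -lquot_piD scalerDr.
Qed.

Fact lquot_scaleDl q : {morph lquot_scale^~ q : a b / a + b}.
Proof.
by move=> a b /=; rewrite -(lquot_reprK q) -!lquot_piZ -lquot_piD scalerDl.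
Qed.

HB.instance Definition _ := GRing.Zmodule_isLmodule.Build R lquot
  lquot_scaleA lquot_scale1 lquot_scaleDr lquot_scaleDl.

End QuotientModule.

Section Products.
Context (R : pzRingType) (T : eqType) (V : T -> lmodType R).

Definition mprod : Type := forall t, V t.

HB.instance Definition _ := Choice.copy mprod (forall t, V t).

Implicit Types s : mprod.

Let addA : associative (fun s s' : mprod => (fun t => s t + s' t) : mprod).
Proof. by move=> ? ? ?; apply: functional_extensionality_dep => t; rewrite addrA. Qed.
Let addC : commutative (fun s s' : mprod => (fun t => s t + s' t) : mprod).
Proof. by move=> ? ?; apply: functional_extensionality_dep => t; rewrite addrC. Qed.
Let add0 : left_id ((fun=> 0) : mprod)
  (fun s s' : mprod => (fun t => s t + s' t) : mprod).
Proof. by move=> ?; apply: functional_extensionality_dep => t; rewrite add0r. Qed.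
Let addN : left_inverse ((fun=> 0) : mprod) (fun s : mprod => (fun t => - s t) : mprod)
  (fun s s' : mprod => (fun t => s t + s' t) : mprod).
Proof. by move=> ?; apply: functional_extensionality_dep => t; rewrite addNr. Qed.

HB.instance Definition _ := GRing.isZmodule.Build mprod addA addC add0 addN.

Let scale (a : R) (s : mprod) : mprod := fun t => a *: s t.
Let scaleA a b s : scale a (scale b s) = scale (a * b) s.
Proof. by apply: functional_extensionality_dep => t; exact: scalerA. Qed.
Let scale1 : left_id 1 scale.
Proof. by move=> s; apply: functional_extensionality_dep => t; exact: scale1r. Qed.
Let scaleDr : right_distributive scale +%R.
Proof. by move=> a s s'; apply: functional_extensionality_dep => t; exact: scalerDr. Qed.
Let scaleDl s : {morph scale^~ s : a b / a + b}.
Proof. by move=> a b; apply: functional_extensionality_dep => t; exact: scalerDl. Qed.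

HB.instance Definition _ :=
  GRing.Zmodule_isLmodule.Build R mprod scaleA scale1 scaleDr scaleDl.

Definition finsupp : {pred mprod} :=
  [pred s | `[< finite_set [set t | s t != 0] >]].

Lemma finsupp_closed : submod_closed finsupp.
Proof.
split=> [|a s s' /asboolP fs /asboolP fs']; apply/asboolP.
  by apply: (sub_finite_set _ (finite_set0 T)) => t /=; rewrite eqxx.
apply: (@sub_finite_set _ _ ([set t | s t != 0] `|` [set t | s' t != 0])).
  move=> t /= h; have [s0|] := eqVneq (s t) 0; last by left.
  by right; move: h; rewrite [X in X != 0](_ : _ = a *: s t + s' t)// s0 scaler0 add0r.
by rewrite finite_setU.
Qed.

HB.instance Definition _ := GRing.isSubmodClosed.Build R mprod finsupp finsupp_closed.

Definition msum : Type := {s : mprod | s \in finsupp}.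

HB.instance Definition _ := [isSub of msum for @sval _ _].
HB.instance Definition _ := [Choice of msum by <:].
HB.instance Definition _ := [SubChoice_isSubLmodule of msum by <:].

Lemma msum_inj_subproof (t : T) (v : V t) :
  (@dfwith T (fun u => V u : Type) (fun=> 0) t v : mprod) \in finsupp.
Proof.
apply/asboolP; apply: (sub_finite_set _ (finite_set1 t)) => u /=.
have [->//|ut] := eqVneq u t; move=> /eqP[].
by apply: dfwith_out; rewrite eq_sym.
Qed.

Definition msum_inj (t : T) (v : V t) : msum :=
  exist (fun s : mprod => s \in finsupp) _ (msum_inj_subproof v).

End Products.

Definition is_basis (k : fieldType) (V : lmodType k) (W : set V)
    (n : nat) (b : 'I_n -> V) : Prop :=
  [/\ forall i, W (b i),
      forall c : 'I_n -> k, \sum_i c i *: b i = 0 -> forall i, c i = 0 &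
      forall v, W v -> exists c : 'I_n -> k, v = \sum_i c i *: b i].

(** Equal to [0] if the image is infinite-dimensional, which does not happen
    for the canonical maps below when the representation is pointwise
    finite-dimensional. *)
Definition lrank (k : fieldType) (U V : lmodType k) (f : U -> V) : nat :=
  xget 0%N [set n | exists b : 'I_n -> V, is_basis (range f) b].

Record rep (k : fieldType) (d : Order.disp_t) (P : porderType d) := Rep {
  robj :> P -> lmodType k;
  rmap : forall x y : P, (x <= y)%O -> {linear robj x -> robj y};
  rmap_id : forall (x : P) (xx : (x <= x)%O) (v : robj x), rmap xx v = v;
  rmap_comp : forall (x y z : P) (xy : (x <= y)%O) (yz : (y <= z)%O)
    (xz : (x <= z)%O) (v : robj x), rmap yz (rmap xy v) = rmap xz v }.

Section Representations.
Context (k : fieldType) (d : Order.disp_t) (P : porderType d).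

Local Notation rep := (rep k P).

Record rhom (M N : rep) := RHom {
  rhom_fun :> forall x : P, {linear M x -> N x};
  rhom_nat : forall (x y : P) (xy : (x <= y)%O) (v : M x),
    rmap N xy (rhom_fun x v) = rhom_fun y (rmap M xy v) }.

Definition isomorphic (M N : rep) : Prop :=
  exists (f : rhom M N) (g : rhom N M),
    (forall x, cancel (f x) (g x)) /\ (forall x, cancel (g x) (f x)).

Section Sum.
Context (M N : rep).

Definition radd_map (x y : P) (xy : (x <= y)%O) (v : (M x * N x)%type) :
  (M y * N y)%type := (rmap M xy v.1, rmap N xy v.2).

Lemma radd_map_linear x y (xy : (x <= y)%O) : linear (radd_map xy).
Proof. by move=> a u v; rewrite /radd_map !linearP. Qed.

HB.instance Definition _ x y (xy : (x <= y)%O) :=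
  GRing.isLinear.Build k (M x * N x)%type (M y * N y)%type _ (radd_map xy)
    (radd_map_linear xy).

Lemma radd_map_id x (xx : (x <= x)%O) v : radd_map xx v = v.
Proof. by case: v => v w; rewrite /radd_map !rmap_id. Qed.

Lemma radd_map_comp x y z (xy : (x <= y)%O) (yz : (y <= z)%O)
  (xz : (x <= z)%O) v : radd_map yz (radd_map xy v) = radd_map xz v.
Proof. by rewrite /radd_map !rmap_comp. Qed.

Definition radd : rep := @Rep k d P (fun x => (M x * N x)%type : lmodType k)
  (fun x y xy => radd_map xy) radd_map_id radd_map_comp.

End Sum.

Definition is_cokernel (A B M : rep) (f : rhom A B) (g : rhom B M) : Prop :=
  (forall x v, g x (f x v) = 0) /\
  forall (N : rep) (h : rhom B N), (forall x v, h x (f x v) = 0) ->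
    exists u : rhom M N, (forall x v, u x (g x v) = h x v) /\
      forall u' : rhom M N, (forall x v, u' x (g x v) = h x v) ->
        forall x v, u' x v = u x v.

(** Representations by coordinate spaces [k^n], acting on row vectors. They
    form a type that is small enough to carry a [choiceType] structure, which
    [rep] is not (for universe reasons), and contain a representative of each
    isomorphism class of pointwise finite-dimensional representations. *)
Record mxrep := MxRep {
  mxdim : P -> nat;
  mxmap : forall x y : P, (x <= y)%O -> 'M[k]_(mxdim x, mxdim y);
  mxmap_id : forall (x : P) (xx : (x <= x)%O), mxmap xx = 1%:M;
  mxmap_comp : forall (x y z : P) (xy : (x <= y)%O) (yz : (y <= z)%O)
    (xz : (x <= z)%O), mxmap xy *m mxmap yz = mxmap xz }.

Arguments mxmap m {x y} xy : rename.

HB.instance Definition _ := gen_eqMixin mxrep.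
HB.instance Definition _ := gen_choiceMixin mxrep.

Lemma rep_of_mx_id (m : mxrep) (x : P) (xx : (x <= x)%O)
  (v : 'rV[k]_(mxdim m x)) : mulmxr (mxmap m xx) v = v.
Proof. by rewrite /= mxmap_id mulmx1. Qed.

Lemma rep_of_mx_comp (m : mxrep) (x y z : P) (xy : (x <= y)%O)
  (yz : (y <= z)%O) (xz : (x <= z)%O) (v : 'rV[k]_(mxdim m x)) :
  mulmxr (mxmap m yz) (mulmxr (mxmap m xy) v) = mulmxr (mxmap m xz) v.
Proof. by rewrite /= -mulmxA mxmap_comp. Qed.

Definition rep_of_mx (m : mxrep) : rep :=
  @Rep k d P (fun x => 'rV[k]_(mxdim m x) : lmodType k)
    (fun x y xy => mulmxr (mxmap m xy)) (@rep_of_mx_id m) (@rep_of_mx_comp m).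

Definition rzero : rep := rep_of_mx
  (@MxRep (fun=> 0%N) (fun _ _ _ => 0) (fun _ _ => esym (flatmx0 _))
    (fun _ _ _ _ _ _ => flatmx0 _)).

Definition is_interval (I : set P) : Prop :=
  [/\ I !=set0,
      forall x y, I x -> I y -> exists s : seq P,
        [/\ forall z, z \in s -> I z, path (>=<%O) x s & last x s = y] &
      forall x y z, I x -> I z -> (x <= y)%O -> (y <= z)%O -> I y].

Record pinterval := PInterval { iset :> set P; pintervalP : is_interval iset }.

HB.instance Definition _ := gen_eqMixin pinterval.
HB.instance Definition _ := gen_choiceMixin pinterval.

(** The interval representation: [k^1] on [I] and [k^0] outside; the
    all-ones matrix is the identity of [k] if both dimensions are [1]. *)
Section IntervalRep.
Context (I : pinterval).

Definition krep_map (x y : P) : 'M[k]_(x \in (I : set P), y \in (I : set P)) :=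
  const_mx 1.

Lemma krep_map_id (x : P) (xx : (x <= x)%O) : krep_map x x = 1%:M.
Proof.
rewrite /krep_map; apply/matrixP => i j; rewrite !mxE.
by case: (x \in (I : set P)) i j => i j; rewrite ?ord1 ?eqxx//; case: i.
Qed.

Lemma krep_map_comp (x y z : P) (xy : (x <= y)%O) (yz : (y <= z)%O)
  (xz : (x <= z)%O) : krep_map x y *m krep_map y z = krep_map x z.
Proof.
have [_ _ cI] := pintervalP I.
have h : x \in (I : set P) -> z \in (I : set P) -> y \in (I : set P).
  by rewrite !inE => Ix Iz; exact: cI Ix Iz xy yz.
rewrite /krep_map; apply/matrixP => i j; rewrite !mxE.
case xI: (x \in (I : set P)) h i => h i; last by case: i.
case zI: (z \in (I : set P)) h j => h j; last by case: j.
rewrite h//; rewrite big_ord1 !mxE mulr1//.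
Qed.

Definition krep : rep :=
  rep_of_mx (MxRep krep_map_id krep_map_comp).

End IntervalRep.

Lemma up_interval (x : P) : is_interval [set y | (x <= y)%O].
Proof.
split=> [|y z /= xy xz|a b c /= xa _ ab _]; last exact: le_trans ab.
  by exists x => /=.
exists [:: x; z]; split=> //=; last by rewrite /Order.comparable xy xz orbT.
by move=> t; rewrite !inE => /orP[] /eqP ->.
Qed.

Definition up (x : P) : pinterval := PInterval (up_interval x).

Definition free_rep (s : seq P) : rep :=
  foldr (fun x N => radd (krep (up x)) N) rzero s.

Definition fpresentable (M : rep) : Prop :=
  exists (s t : seq P) (f : rhom (free_rep s) (free_rep t))
    (g : rhom (free_rep t) M), is_cokernel f g.

Record fprep := FPRep { fp_rep :> rep; fp_repP : fpresentable fp_rep }.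

Record fpinterval := FPInterval {
  fp_interval :> pinterval; fp_intervalP : fpresentable (krep fp_interval) }.

HB.instance Definition _ := gen_eqMixin fpinterval.
HB.instance Definition _ := gen_choiceMixin fpinterval.

Definition fp_krep (J : fpinterval) : fprep := FPRep (fp_intervalP J).

Lemma isomorphic_refl M : isomorphic M M.
Proof.
pose i : rhom M M := @RHom M M (fun x => idfun) (fun x y xy v => erefl).
by exists i, i.
Qed.

Lemma isomorphic_sym M N : isomorphic M N -> isomorphic N M.
Proof. by case=> f [g [fK gK]]; exists g, f. Qed.

Lemma isomorphic_trans M N L :
  isomorphic M N -> isomorphic N L -> isomorphic M L.
Proof.
case=> f [g [fK gK]] [f' [g' [fK' gK']]].
have fN x y (xy : (x <= y)%O) v :
    rmap L xy ((f' x \o f x) v) = (f' y \o f y) (rmap M xy v).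
  by rewrite /= !rhom_nat.
have gN x y (xy : (x <= y)%O) v :
    rmap M xy ((g x \o g' x) v) = (g y \o g' y) (rmap L xy v).
  by rewrite /= !rhom_nat.
exists (@RHom M L (fun x => f' x \o f x) fN).
exists (@RHom L M (fun x => g x \o g' x) gN).
by split=> x v /=; rewrite ?fK' ?fK ?gK ?gK'.
Qed.

Record fpmx := FPMx { fp_mx : mxrep; fp_mxP : fpresentable (rep_of_mx fp_mx) }.

HB.instance Definition _ := gen_eqMixin fpmx.
HB.instance Definition _ := gen_choiceMixin fpmx.

Definition rep_of_fpmx (m : fpmx) : fprep := FPRep (fp_mxP m).

Definition fpmx_iso : rel fpmx := fun m n =>
  `[< isomorphic (rep_of_fpmx m) (rep_of_fpmx n) >].

Lemma fpmx_iso_equiv : equiv_class_of fpmx_iso.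
Proof.
split=> [m|m n|n m l].
- by apply/asboolP; exact: isomorphic_refl.
- by apply/asboolP/asboolP => /isomorphic_sym.
- by move=> /asboolP mn /asboolP nl; apply/asboolP; exact: isomorphic_trans nl.
Qed.

Canonical fpmx_iso_equiv_rel := EquivRelPack fpmx_iso_equiv.
Canonical fpmx_iso_encModRel := defaultEncModRel fpmx_iso.

(** Isomorphism classes of finitely presentable representations, as classes of
    their coordinate models. *)
Definition isoclass : Type := {eq_quot fpmx_iso}.
HB.instance Definition _ := Choice.on isoclass.

Definition in_isoclass (M : rep) (c : isoclass) : Prop :=
  exists m : fpmx, isomorphic (rep_of_fpmx m) M /\ c = \pi_{eq_quot fpmx_iso} m.

Definition split_relations : set {freeg isoclass} :=
  [set z | exists (M N : fprep) (cM cN cS : isoclass),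
    [/\ in_isoclass M cM, in_isoclass N cN, in_isoclass (radd M N) cS &
        z = << cS >> - (<< cM >> + << cN >>)]].

Definition K0sp : Type := {ideal_quot (zspan split_relations)}.
HB.instance Definition _ := GRing.Zmodule.on K0sp.

Definition K0class (M : fprep) : K0sp :=
  xget 0 [set z | exists2 c, in_isoclass M c &
                    z = \pi_{ideal_quot (zspan split_relations)} << c >>].

Definition K0C_pred : {pred K0sp} :=
  zspan [set K0class (fp_krep J) | J in [set: fpinterval]].
HB.instance Definition _ := GRing.ZmodClosed.on K0C_pred.

Definition K0C : Type := {x : K0sp | x \in K0C_pred}.
HB.instance Definition _ := [isSub of K0C for @sval _ _].
HB.instance Definition _ := [Choice of K0C by <:].
HB.instance Definition _ := [SubChoice_isSubZmodule of K0C by <:].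

(** The extension to [K0sp] of a function [h] on finitely presentable
    representations, by [h ([M] - [N]) = h M - h N]. *)
Definition K0ext (A : zmodType) (h : fprep -> A) (x : K0sp) : A :=
  xget 0 [set a | exists M N : fprep,
                    x = K0class M - K0class N /\ a = h M - h N].

Section Rank.
Context (M : rep) (I : pinterval).

Definition ipoint : Type := set_type (iset I).
HB.instance Definition _ := Choice.on ipoint.

Definition restr (x : ipoint) : lmodType k := M (val x).

Definition compatible : {pred mprod restr} :=
  [pred s | `[< forall (x y : ipoint) (xy : (val x <= val y)%O),
                  rmap M xy (s x) = s y >]].

Lemma compatible_closed : submod_closed compatible.
Proof.
split=> [|a s s' /asboolP cs /asboolP cs']; apply/asboolP => x y xy.
  by rewrite linear0.
by rewrite linearP cs cs'.
Qed.

HB.instance Definition _ :=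
  GRing.isSubmodClosed.Build k (mprod restr) compatible compatible_closed.

Definition rlim : Type := {s : mprod restr | s \in compatible}.
HB.instance Definition _ := [isSub of rlim for @sval _ _].
HB.instance Definition _ := [Choice of rlim by <:].
HB.instance Definition _ := [SubChoice_isSubLmodule of rlim by <:].

Definition colim_relations : set (msum restr) :=
  [set z | exists (x y : ipoint) (xy : (val x <= val y)%O) (v : M (val x)),
    z = msum_inj (V := restr) (t := y) (rmap M xy v) -
        msum_inj (V := restr) (t := x) v].

Definition rcolim : lmodType k := lquot colim_relations.

Definition rlim_proj (x : ipoint) (s : rlim) : M (val x) := val s x.

Definition rcolim_inj (x : ipoint) (v : M (val x)) : rcolim :=
  lquot_pi colim_relations (msum_inj (V := restr) (t := x) v).

Lemma ipoint_inhabited : exists x : P, x \in iset I.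
Proof. by have [[x Ix] _ _] := pintervalP I; exists x; rewrite inE. Qed.

Definition base_point : ipoint :=
  exist (fun x : P => x \in iset I) _ (xchooseP ipoint_inhabited).

(** As [I] is connected, the composite [lim -> M x -> colim] does not depend on
    the point [x] of [I]. *)
Definition canonical_map (s : rlim) : rcolim :=
  rcolim_inj (rlim_proj base_point s).

End Rank.

Definition grank (M : rep) (I : pinterval) : int :=
  (lrank (canonical_map (M := M) (I := I)))%:Z.

Definition rkInt : K0sp -> (pinterval -> int) := K0ext (fun M : fprep => grank M).

Definition is_diagram (r d : pinterval -> int) : Prop :=
  forall I : pinterval,
    finite_set [set J : pinterval | iset I `<=` iset J /\ d J != 0] /\
    r I = \sum_(J \in [set J : pinterval | iset I `<=` iset J]) d J.

(** "The unique [d] such that ...", with a dummy value if there is none. *)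
Definition diagram (M : rep) : pinterval -> int :=
  xget 0 [set d | unique (is_diagram (grank M)) d].

(** A finitely supported function [d] on the finitely presentable intervals is
    identified with the sum of the [d J *: [k_J]]. *)
Definition diagram_sum (M : rep) : K0sp :=
  \sum_(J \in [set: fpinterval]) K0class (fp_krep J) *~ diagram M J.

Lemma diagram_sum_subproof (M : rep) : diagram_sum M \in K0C_pred.
Proof.
rewrite /diagram_sum; apply: rpred_sum => J _; apply: rpredMz.
by apply/asboolP => S _; apply; exists J.
Qed.

Definition dgm_rep (M : rep) : K0C :=
  exist (fun x : K0sp => x \in K0C_pred) _ (diagram_sum_subproof M).

Definition dgmInt : K0sp -> K0C := K0ext (fun M : fprep => dgm_rep M).

End Representations.

Definition invariant_ker (U V : zmodType) (f : U -> V) : set U := f @^-1` [set 0].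

(** The posets under consideration; [R *p R] carries the product order. *)
Inductive line_plane_or_finite (R : realType) :
  forall d : Order.disp_t, porderType d -> Prop :=
| IsLine : line_plane_or_finite R (R : porderType _)
| IsPlane : line_plane_or_finite R ((R *p R)%type : porderType _)
| IsFinite (d : Order.disp_t) (P : finPOrderType d) :
    line_plane_or_finite R (P : porderType d).

(* Main.v *)
Require Import Defs.
From HB Require Import structures.
From mathcomp Require Import all_boot all_order all_algebra.
From mathcomp Require Import all_classical all_reals.
From mathcomp Require Import freeg.

Set Implicit Arguments.
Unset Strict Implicit.
Unset Printing Implicit Defensive.

Import Order.TTheory GRing.Theory Num.Theory.

Local Open Scope classical_set_scope.
Local Open Scope quotient_scope.
Local Open Scope ring_scope.

(** By uniqueness of diagrams, everything reduces to their existence: every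
    finitely presentable [M] has the generalized rank of a [Z]-combination of
    finitely presentable intervals.

    The generators and relations of [M] lie in a finite grid [G]; comparing
    points by the grid coordinates below them gives a preorder [q] coarser than
    [<=] with finitely many classes, and the functor [M] extends to [q]. For an
    interval [I] let [hull I] be the set of points lying [q]-between two points
    of [I]. In a chain, the plane or a finite poset, the points of [I] that are
    [q]-below (or [q]-above) a point of [hull I] are connected to each other
    inside [I], so that the limit and the colimit of [M] over [I] and over
    [hull I] give the same rank. There are only finitely many hulls, and
    Moebius inversion over them yields the diagram. It lives on hulls in which
    every point is above a point of [G], because [M] vanishes at the other
    points, and the interval representations of such hulls are finitely
    presentable. *)

(** * Linear algebra over a field *)

(** The obstacle is finiteness: infinitely many intervals may contain a given one, so the relation
    between rank and diagram cannot be inverted by direct recursion. The preorder [q] has to be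
    coarse enough for finitely many classes and fine enough for [M] to remain a functor on it. The
    latter works because every point above some grid point has a largest grid point below it, where
    [M] takes the same value up to isomorphism. Connectedness is what makes passing to the hull
    legitimate: a compatible family on [I] is carried to a hull point [h] from some point of [I]
    below it, and the result must not depend on that point. Only here does the shape of the poset
    matter beyond its grids. The reduction to existence rests on one computation: [k_J] has rank 1
    over [I] if [I] is contained in [J], and 0 otherwise. Hence replacing [x] by its diagram
    preserves the rank, so [x] minus its diagram lies in the kernel of the rank invariant. A
    homomorphism with this kernel that fixes intervals therefore agrees with the diagram at [x]. *)

Section Dimension.
Variable k : fieldType.
Implicit Types U V : lmodType k.

Definition has_dim V (W : set V) (n : nat) :=
  exists b : 'I_n -> V, is_basis W b.

Definition in_span V n (e : 'I_n -> V) : set V :=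
  [set v | exists c : 'I_n -> k, v = \sum_i c i *: e i].

Definition is_submod V (W : set V) :=
  W 0 /\ forall a u v, W u -> W v -> W (a *: u + v).

Lemma submod_sum V (W : set V) n (c : 'I_n -> k) (e : 'I_n -> V) :
  is_submod W -> (forall i, W (e i)) -> W (\sum_i c i *: e i).
Proof.
move=> [W0 WD] We; elim/big_ind: _ => [|u v Wu Wv|i _]//.
  by rewrite -[u]scale1r; apply: WD.
by rewrite -[_ *: _]addr0; apply: WD.
Qed.

(** If [n < m], the [m] by [n] matrix of coefficients has a nonzero row vector in its left kernel,
    and this row is a linear relation between the [b i]. *)
Lemma free_le_span V m n (b : 'I_m -> V) (e : 'I_n -> V) :
  (forall c : 'I_m -> k, \sum_i c i *: b i = 0 -> forall i, c i = 0) ->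
  (forall i, in_span e (b i)) -> (m <= n)%N.
Proof.
move=> fb /choice[c bE]; pose C : 'M[k]_(m, n) := \matrix_(i, j) c i j.
rewrite leqNgt; apply/negP => ltnm.
have : kermx C != 0.
  by rewrite -mxrank_eq0 mxrank_ker subn_eq0 -ltnNge (leq_ltn_trans (rank_leq_col C)).
move=> /rowV0Pn[u /sub_kermxP uC /eqP[]].
apply/rowP => i; rewrite mxE; apply: (fb (fun i => u 0 i)).
transitivity (\sum_j (u *m C) 0 j *: e j); last first.
  by rewrite uC big1// => j _; rewrite mxE scale0r.
under eq_bigr do rewrite bE scaler_sumr.
rewrite exchange_big; apply: eq_bigr => j _ /=.
rewrite mxE scaler_suml; apply: eq_bigr => l _.
by rewrite mxE scalerA.
Qed.

Lemma has_dim_inj V (W : set V) m n : has_dim W m -> has_dim W n -> m = n.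
Proof.
move=> [b [Wb fb sb]] [e [We fe se]]; apply/eqP; rewrite eqn_leq.
by rewrite (free_le_span fb (fun i => se _ (Wb i)))
           (free_le_span fe (fun i => sb _ (We i))).
Qed.

Lemma lrank_has_dim U V (f : U -> V) n : has_dim (range f) n -> lrank f = n.
Proof. by move=> fn; apply: xget_unique => // m fm; apply: has_dim_inj fm fn. Qed.

Lemma submod_has_dim V (W : set V) n (e : 'I_n -> V) :
  is_submod W -> W `<=` in_span e -> exists m, has_dim W m.
Proof.
move=> Wsub We.
(* A basis is an independent family in [W] of maximal size: [free_le_span] bounds the size by [n],
   and a vector outside the span would enlarge the family. *)
pose indep m := `[< exists b : 'I_m -> V, (forall i, W (b i)) /\
  forall c : 'I_m -> k, \sum_i c i *: b i = 0 -> forall i, c i = 0 >].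
have ex0 : exists m, indep m.
  by exists 0%N; apply/asboolP; exists (fun=> 0); split=> [[]//|c _ []].
have ub m : indep m -> (m <= n)%N.
  by move=> /asboolP[b [Wb fb]]; apply: free_le_span fb _ => i; apply: We.
case: (ex_maxnP ex0 ub) => m /asboolP[b [Wb fb]] max_m.
exists m, b; split=> // v Wv.
apply: contrapT => nv; suff : indep m.+1 by move=> /max_m; rewrite ltnn.
apply/asboolP; exists (fun i => if unlift ord0 i is Some j then b j else v).
split=> [i|c]; first by case: unliftP.
rewrite big_ord_recl unlift_none /=.
under eq_bigr do rewrite liftK.
move=> ceq; have c0 : c ord0 = 0.
  apply/eqP/negP => /negP c0; apply: nv.
  exists (fun i => - (c ord0)^-1 * c (fintype.lift ord0 i)).
  under eq_bigr do rewrite -scalerA.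
  move: ceq => /eqP; rewrite -scaler_sumr addrC addr_eq0 => /eqP ->.
  by rewrite scalerN scaleNr opprK scalerA mulVf// scale1r.
move: ceq; rewrite c0 scale0r add0r => /fb cl i.
by case: (unliftP ord0 i) => [j ->|->].
Qed.

Lemma has_dim_image U V (f : {linear U -> V}) (W : set U) n :
  is_submod W -> (forall u, W u -> f u = 0 -> u = 0) ->
  has_dim W n -> has_dim (f @` W) n.
Proof.
move=> Wsub finj [b [Wb fb sb]]; exists (f \o b); split.
- by move=> i; exists (b i).
- move=> c ceq; apply: fb; apply: finj; first exact: submod_sum.
  by rewrite linear_sum -[RHS]ceq; apply: eq_bigr => i _; rewrite linearZ.
- move=> _ [u Wu <-]; have [c ->] := sb _ Wu; exists c.
  by rewrite linear_sum; apply: eq_bigr => i _; rewrite linearZ.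
Qed.

Lemma has_dim_prod U V (W : set U) (W' : set V) m n :
  is_submod W -> is_submod W' ->
  has_dim W m -> has_dim W' n -> has_dim (W `*` W') (m + n).
Proof.
move=> [W0 _] [W0' _] [b [Wb fb sb]] [e [We fe se]].
pose h (i : 'I_(m + n)) : (U * V)%type :=
  match fintype.split i with inl j => (b j, 0) | inr j => (0, e j) end.
have hl i : h (lshift n i) = (b i, 0).
  by rewrite /h; case: splitP => j; [move=> /= /val_inj ->|
    move=> /= eq_ij; have := ltn_ord i; rewrite eq_ij ltnNge leq_addr].
have hr i : h (rshift m i) = (0, e i).
  rewrite /h; case: splitP => j /=; last by move=> /addnI /val_inj ->.
  by move=> eq_ij; have := ltn_ord j; rewrite -eq_ij ltnNge leq_addr.
have hsum c : \sum_i c i *: h i =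
    (\sum_i c (lshift n i) *: b i, \sum_i c (rshift m i) *: e i).
  rewrite big_split_ord /=.
  under eq_bigr do rewrite hl.
  under [X in _ + X]eq_bigr do rewrite hr.
  apply: injective_projections => /=.
    rewrite [LHS](raddfD (@fst U V)) !(raddf_sum (@fst U V)) /=.
    by rewrite [X in _ + X]big1 ?addr0// => i _; rewrite scaler0.
  rewrite [LHS](raddfD (@snd U V)) !(raddf_sum (@snd U V)) /=.
  by rewrite [X in X + _]big1 ?add0r// => i _; rewrite scaler0.
exists h; split.
- by move=> i; rewrite /h; case: splitP => j _; split=> /=.
- move=> c; rewrite hsum => -[/fb cl /fe cr] i.
  by case: (split_ordP i) => j ->.
- move=> [u v] [/= /sb[c ->] /se[c' ->]].
  exists (fun i => match fintype.split i with inl j => c j | inr j => c' j end).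
  rewrite hsum; congr (_, _); apply: eq_bigr => i _; congr (_ *: _).
    by rewrite -[lshift n i]/(unsplit (inl i)) unsplitK.
  by rewrite -[rshift m i]/(unsplit (inr i)) unsplitK.
Qed.

Definition fin_dim V := exists n (e : 'I_n -> V), forall v, in_span e v.

Lemma fin_dim_surj U V (f : {linear U -> V}) :
  (forall v, exists u, f u = v) -> fin_dim U -> fin_dim V.
Proof.
move=> fS [n [e eS]]; exists n, (f \o e) => v.
have [u <-] := fS v; have [c ->] := eS u; exists c.
by rewrite linear_sum; apply: eq_bigr => i _; rewrite linearZ.
Qed.

Lemma fin_dim_basis V : fin_dim V -> exists n, has_dim [set: V] n.
Proof. by case=> n [e eS]; apply: (@submod_has_dim _ _ n e) => // v _; apply: eS. Qed.

Lemma has_dim_fin_dim V n : has_dim [set: V] n -> fin_dim V.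
Proof. by case=> b [_ _ sb]; exists n, b => v; apply: sb. Qed.

Lemma fin_dim_prod U V : fin_dim U -> fin_dim V -> fin_dim (U * V)%type.
Proof.
move=> /fin_dim_basis[m hm] /fin_dim_basis[n hn].
by apply: (@has_dim_fin_dim _ (m + n)); rewrite -setXTT; apply: has_dim_prod.
Qed.

Lemma fin_dim_rV n : fin_dim 'rV[k]_n.
Proof.
exists n, (fun i => delta_mx 0 i) => v; exists (fun i => v 0 i).
exact: row_sum_delta.
Qed.

Lemma bij_linear_inv U V (f : {linear U -> V}) : bijective f ->
  exists g : {linear V -> U}, cancel f g /\ cancel g f.
Proof.
case=> g fK gK.
pose G : {linear V -> U} := HB.pack g
  (GRing.isLinear.Build _ _ _ _ g (can2_linear fK gK)).
by exists G.
Qed.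

Lemma ker0_inj U V (f : {linear U -> V}) : (forall u, f u = 0 -> u = 0) -> injective f.
Proof.
by move=> f0 u v e; apply/eqP; rewrite -subr_eq0; apply/eqP/f0; rewrite linearB e subrr.
Qed.

Lemma inj_surj_bij (T T' : Type) (f : T -> T') :
  injective f -> (forall y, exists x, f x = y) -> bijective f.
Proof. by move=> fI /choice[g gK]; exists g => // x; apply: fI; rewrite gK. Qed.

End Dimension.

(** * Limits and colimits over an interval *)

Lemma pinterval_eq (d : Order.disp_t) (P : porderType d)
  (I J : pinterval P) : iset I = iset J -> I = J.
Proof.
case: I J => I hI [J hJ] /= IJ; move: hJ; rewrite -IJ => hJ; congr PInterval; apply: Prop_irrelevance.
Qed.

Section QuotientDescent.
Variables (k : fieldType) (V W : lmodType k) (A : set V).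

Lemma lquot_pi_linear : linear (@lquot_pi k V A : V -> lquot A).
Proof. by move=> a u v; rewrite lquot_piD lquot_piZ. Qed.

HB.instance Definition _ :=
  GRing.isLinear.Build k V (lquot A) _ (@lquot_pi k V A) lquot_pi_linear.

Lemma lspan_incl (a : V) : A a -> a \in lspan A.
Proof. by move=> Aa; apply/asboolP => S _; apply. Qed.

Lemma lspan_submod (S : set V) : is_submod S -> A `<=` S ->
  forall v, v \in lspan A -> S v.
Proof.
move=> [S0 SD] AS v /asboolP /(_ (fun v => `[< S v >])) h.
apply/asboolP; apply: h; last by move=> a /AS Sa; apply/asboolP.
split; first exact/asboolP.
by move=> a u w /asboolP Su /asboolP Sw; apply/asboolP; apply: SD.
Qed.

Lemma lquot_desc (f : {linear V -> W}) : (forall a, A a -> f a = 0) ->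
  exists F : {linear lquot A -> W}, forall v, F (lquot_pi A v) = f v.
Proof.
move=> fA.
pose F (q : lquot A) : W := f (repr (q : {ideal_quot (lspan A)})).
have FE v : F (lquot_pi A v) = f v.
  apply/eqP; rewrite -subr_eq0 -linearB; apply/eqP.
  apply: (@lspan_submod (fun v => f v = 0)) => //.
    by split=> [|a u w fu fw]; rewrite ?linear0// linearP fu fw scaler0 addr0.
  by apply/lquot_piP; rewrite lquot_reprK.
have Flin : linear F.
  move=> a p q; rewrite -(lquot_reprK p) -(lquot_reprK q).
  by rewrite -linearP !FE linearP.
pose F' : {linear lquot A -> W} := HB.pack F (GRing.isLinear.Build _ _ _ _ F Flin).
by exists F'.
Qed.

End QuotientDescent.

Section DirectSum.
Variables (k : fieldType) (T : choiceType) (V : T -> lmodType k) (W : lmodType k).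

Lemma msum_injE t (v : V t) : val (msum_inj v) t = v.
Proof. exact: dfwithin. Qed.

Lemma msum_inj_out t u (v : V t) : t != u -> val (msum_inj v) u = 0.
Proof. exact: dfwithout. Qed.

Lemma msum_inj_linear t : linear (@msum_inj k T V t).
Proof.
move=> a u v; apply: val_inj; apply: functional_extensionality_dep => s.
rewrite [RHS](_ : _ = a *: val (msum_inj u) s + val (msum_inj v) s)//.
have [<-|ts] := eqVneq t s; first by rewrite !msum_injE.
by rewrite !msum_inj_out// scaler0 addr0.
Qed.

HB.instance Definition _ t :=
  GRing.isLinear.Build k (V t) (msum V) _ (@msum_inj k T V t) (@msum_inj_linear t).

Lemma msum_desc (f : forall t, {linear V t -> W}) :
  exists F : {linear msum V -> W}, forall t v, F (msum_inj (t := t) v) = f t v.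
Proof.
pose F (s : msum V) : W := \sum_(t \in [set: T]) f t (val s t).
have supp (s : msum V) : exists2 r : seq T, uniq r & forall t, t \notin r -> val s t = 0.
  have /asboolP /finite_seqP[r rE] := valP s.
  exists (undup r); first exact: undup_uniq.
  move=> t; rewrite mem_undup => tr; apply/eqP; apply: contraNT tr => st.
  by have : [set` r] t by rewrite -rE.
have FE (s : msum V) r : uniq r -> (forall t, t \notin r -> val s t = 0) ->
    F s = \sum_(t <- r) f t (val s t).
  move=> ur sr; rewrite /F (fsbigE r)//; last first.
    by move=> t _ /sr ->; rewrite linear0.
  by apply: eq_bigl => t; rewrite in_setT.
have Flin : linear F.
  move=> a s s'; have [r ur sr] := supp s; have [r' ur' sr'] := supp s'.
  (* A list covering both supports reduces linearity to a statement on finite sums. *)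
  pose q := undup (r ++ r').
  have uq : uniq q by exact: undup_uniq.
  have qP t : t \notin q -> val s t = 0 /\ val s' t = 0.
    by rewrite mem_undup mem_cat negb_or => /andP[/sr ? /sr' ?].
  rewrite (FE s q)//; last by move=> t /qP[].
  rewrite (FE s' q)//; last by move=> t /qP[].
  have E t : val (a *: s + s') t = a *: val s t + val s' t by [].
  rewrite (FE _ q)//; last by move=> t /qP[st s't]; rewrite E st s't scaler0 addr0.
  by rewrite scaler_sumr -big_split; apply: eq_bigr => t _; rewrite E linearP.
have FI t v : F (msum_inj (t := t) v) = f t v.
  rewrite (FE _ [:: t])//; last first.
    by move=> u; rewrite inE eq_sym => /msum_inj_out ->.
  by rewrite big_seq1 msum_injE.
pose F' : {linear msum V -> W} := HB.pack F (GRing.isLinear.Build _ _ _ _ F Flin).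
by exists F'.
Qed.

End DirectSum.

Section Colimit.
Variables (k : fieldType) (d : Order.disp_t) (P : porderType d).
Implicit Types (M N : rep k P) (I J : pinterval P).

Definition mkpoint I x (Ix : iset I x) : ipoint I := exist _ x (mem_set Ix).

Lemma ipointP I (x : ipoint I) : iset I (val x).
Proof. exact: set_mem (valP x). Qed.

Lemma rcolim_inj_linear M I (x : ipoint I) : linear (@rcolim_inj k d P M I x).
Proof. by move=> a u v; rewrite /rcolim_inj !linearP. Qed.

HB.instance Definition _ M I (x : ipoint I) :=
  GRing.isLinear.Build k (M (val x)) (rcolim M I) _ (@rcolim_inj k d P M I x)
    (@rcolim_inj_linear M I x).

Lemma rcolim_inj_nat M I (x y : ipoint I) (xy : (val x <= val y)%O)
  (v : M (val x)) : rcolim_inj (x := y) (rmap M xy v) = rcolim_inj (x := x) v.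
Proof. by apply/lquot_piP/lspan_incl; exists x, y, xy, v. Qed.

Lemma rcolim_desc M I (W : lmodType k)
    (f : forall x : ipoint I, {linear M (val x) -> W}) :
  (forall (x y : ipoint I) (xy : (val x <= val y)%O) v,
      f y (rmap M xy v) = f x v) ->
  exists F : {linear rcolim M I -> W}, forall x v, F (rcolim_inj (x := x) v) = f x v.
Proof.
move=> fnat; have [G GE] := msum_desc f.
have [|F FE] := @lquot_desc _ _ _ (@colim_relations k d P M I) G.
  by move=> _ [x [y [xy [v ->]]]]; rewrite linearB !GE fnat subrr.
by exists F => x v; rewrite FE GE.
Qed.

(** Same shape as the connectedness clause of [is_interval]: the vertices after [x] lie in [A],
    while [x] itself is not constrained. *)
Definition linked (A : set P) x y := exists s : seq P,
  [/\ forall z, z \in s -> A z, path (>=<%O) x s & last x s = y].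

Lemma linked_ind (A Q : set P) :
  (forall p q, A p -> A q -> (p >=< q)%O -> Q p -> Q q) ->
  forall x y, A x -> linked A x y -> Q x -> Q y.
Proof.
move=> QS x y Ax [s []]; elim: s x Ax => [x _ _ _ <-//|z s IHs] x Ax As /=.
move=> /andP[xz zs] lz Qx.
have Az : A z by apply: As; rewrite mem_head.
apply: (IHs z) => //; last exact: QS Qx.
by move=> w ws; apply: As; rewrite inE ws orbT.
Qed.

Lemma linked_refl A x : linked A x x.
Proof. by exists [::]. Qed.

Lemma linked_trans A x y z : linked A x y -> linked A y z -> linked A x z.
Proof.
move=> [s [As ps <-]] [t [At pt <-]]; exists (s ++ t); split.
- by move=> w; rewrite mem_cat => /orP[/As|/At].
- by rewrite cat_path ps pt.
- by rewrite last_cat.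
Qed.

Lemma linked1 (A : set P) x y : A y -> (x >=< y)%O -> linked A x y.
Proof. by move=> Ay xy; exists [:: y]; split=> //= [z|]; rewrite ?inE ?xy// => /eqP ->. Qed.

Lemma linked_sub (A B : set P) x y : A `<=` B -> linked A x y -> linked B x y.
Proof. by move=> AB [s [As ps ls]]; exists s; split=> // z /As /AB. Qed.

Lemma interval_linked I x y : iset I x -> iset I y -> linked (iset I) x y.
Proof. by case: (pintervalP I) => _ + _; apply. Qed.

Lemma interval_ind I (Q : ipoint I -> Prop) :
  (forall x y, (val x <= val y)%O -> Q x <-> Q y) -> forall x y, Q x -> Q y.
Proof.
move=> QS x y Qx.
(* Quantifying over the membership proof turns a predicate on points of [I] into one on [P], to
   which [linked_ind] applies. *)
pose Q' p := forall Ip : iset I p, Q (mkpoint Ip).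
have mkE (z : ipoint I) (Iz : iset I (val z)) : mkpoint Iz = z by exact: val_inj.
suff Q'y : Q' (val y) by rewrite -(mkE y (ipointP y)); apply: Q'y.
apply: (@linked_ind (iset I) Q' _ (val x)).
- move=> p q Ip Iq /orP[pq|qp] Q'p Iq'.
    by have [h _] := QS (mkpoint Ip) (mkpoint Iq') pq; apply: h.
  by have [_ h] := QS (mkpoint Iq') (mkpoint Ip) qp; apply: h.
- exact: ipointP.
- by apply: interval_linked; apply: ipointP.
- by move=> Ix; rewrite mkE.
Qed.

Lemma rlim_proj_nat M I (x y : ipoint I) (xy : (val x <= val y)%O) (s : rlim M I) :
  rmap M xy (rlim_proj x s) = rlim_proj y s.
Proof. by have /asboolP := valP s; apply. Qed.

Lemma canonical_mapE M I (x : ipoint I) (s : rlim M I) :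
  canonical_map s = rcolim_inj (x := x) (rlim_proj x s).
Proof.
pose Q y := rcolim_inj (rlim_proj y s) = canonical_map s.
suff : Q x by move=> /esym.
apply: (@interval_ind _ Q _ (base_point I)) => // y z yz.
by rewrite /Q -(rlim_proj_nat yz) rcolim_inj_nat.
Qed.

Lemma canonical_map_linear M I : linear (@canonical_map k d P M I).
Proof. by move=> a s s'; rewrite /canonical_map -linearP. Qed.

HB.instance Definition _ M I :=
  GRing.isLinear.Build k (rlim M I) (rcolim M I) _ (@canonical_map k d P M I)
    (@canonical_map_linear M I).

Lemma range_submod (U V : lmodType k) (f : {linear U -> V}) : is_submod (range f).
Proof.
split; first by exists 0; rewrite // linear0.
by move=> a _ _ [u _ <-] [v _ <-]; exists (a *: u + v); rewrite // linearP.
Qed.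

(** The canonical map factors through every fibre over [I], so one finite-dimensional fibre bounds
    the rank, whatever the size of the limit and the colimit. *)
Lemma canonical_has_dim M I : (exists2 x, iset I x & fin_dim (M x)) ->
  exists n, has_dim (range (@canonical_map k d P M I)) n.
Proof.
move=> [x Ix [n [e eS]]].
pose e' i := rcolim_inj (x := mkpoint Ix) (e i : M (val (mkpoint Ix))).
apply: (@submod_has_dim _ _ _ n e'); first exact: range_submod.
move=> _ [s _ <-]; rewrite (canonical_mapE (mkpoint Ix)).
have [c ->] := eS (rlim_proj (mkpoint Ix) s); exists c.
by rewrite linear_sum; apply: eq_bigr => i _; rewrite linearZ.
Qed.

Definition pfd M := forall x, fin_dim (M x).

Lemma pfd_canonical_has_dim M I : pfd M ->
  exists n, has_dim (range (@canonical_map k d P M I)) n.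
Proof.
by move=> fM; apply: canonical_has_dim; have [[x Ix] _ _] := pintervalP I; exists x.
Qed.

Lemma grank_has_dim M I n :
  has_dim (range (@canonical_map k d P M I)) n -> grank M I = n%:Z.
Proof. by move=> /lrank_has_dim rn; rewrite /grank rn. Qed.

Lemma has_dim_set0 (V : lmodType k) (W : set V) :
  W 0 -> (forall v, W v -> v = 0) -> has_dim W 0.
Proof.
move=> W0 WE; exists (fun=> 0); split=> // [c _ []//|v /WE ->].
by exists (fun=> 0); rewrite big_ord0.
Qed.

Lemma grank_eq0 M I (x : P) : iset I x -> (forall v : M x, v = 0) -> grank M I = 0.
Proof.
move=> Ix M0; apply: grank_has_dim; apply: has_dim_set0.
  exact: (range_submod (@canonical_map k d P M I)).1.
by move=> _ [s _ <-]; rewrite (canonical_mapE (mkpoint Ix)) [rlim_proj _ _]M0 linear0.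
Qed.

End Colimit.

(** * The generalized rank *)

Section GeneralizedRank.
Variables (k : fieldType) (d : Order.disp_t) (P : porderType d).
Implicit Types (M N : rep k P) (I J : pinterval P).

Lemma rlim_mk M I (s : forall x : ipoint I, M (val x)) :
  (forall (x y : ipoint I) (xy : (val x <= val y)%O), rmap M xy (s x) = s y) ->
  exists s' : rlim M I, forall x, rlim_proj x s' = s x.
Proof.
move=> sP; have sC : (s : mprod (restr M (I := I))) \in @compatible k d P M I by exact/asboolP.
by exists (exist (fun s : mprod (restr M (I := I)) => s \in @compatible k d P M I) _ sC).
Qed.

Lemma rlim_map M N I (f : rhom M N) (s : rlim M I) :
  exists s' : rlim N I, forall x, rlim_proj x s' = f (val x) (rlim_proj x s).
Proof.
by apply: rlim_mk => x y xy; rewrite rhom_nat rlim_proj_nat.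
Qed.

Lemma rcolim_map M N I (f : rhom M N) :
  exists F : {linear rcolim M I -> rcolim N I},
    (forall x v, F (rcolim_inj (x := x) v) = rcolim_inj (x := x) (f (val x) v)) /\
    F @` range (@canonical_map k d P M I) `<=` range (@canonical_map k d P N I).
Proof.
have [|F FE] := @rcolim_desc k d P M I (rcolim N I)
  (fun x => (@rcolim_inj k d P N I x : {linear _ -> _}) \o f (val x)).
  by move=> x y xy v /=; rewrite -rhom_nat rcolim_inj_nat.
exists F; split=> [//|_ [_ [s _ <-] <-]].
have [s' s'E] := rlim_map f s; exists s' => //.
by rewrite /canonical_map s'E FE.
Qed.

Lemma grank_iso M N I : pfd M -> isomorphic M N -> grank M I = grank N I.
Proof.
move=> fM [f [g [fK gK]]].
have [F [FE Fr]] := rcolim_map I f; have [G [GE Gr]] := rcolim_map I g.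
have [n Mn] := pfd_canonical_has_dim I fM.
have GF v : range (@canonical_map k d P M I) v -> G (F v) = v.
  by move=> [s _ <-]; rewrite /canonical_map FE GE fK.
rewrite (grank_has_dim Mn); apply/esym/grank_has_dim.
have -> : range (@canonical_map k d P N I) = F @` range (@canonical_map k d P M I).
  apply/seteqP; split=> // v Nv; exists (G v); first by apply: Gr; exists v.
  by case: Nv => s _ <-; rewrite /canonical_map GE FE gK.
apply: has_dim_image Mn; first exact: range_submod.
by move=> u /GF {2}<- ->; rewrite linear0.
Qed.

Lemma pfd_iso M N : isomorphic M N -> pfd M -> pfd N.
Proof.
by move=> [f [g [_ gK]]] fM x; apply: fin_dim_surj (f x) _ (fM x) => v; exists (g x v); apply: gK.
Qed.

Lemma pfd_radd M N : pfd M -> pfd N -> pfd (radd M N).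
Proof. by move=> fM fN x; apply: fin_dim_prod. Qed.

Section Biproduct.
Variables M N : rep k P.

Let inl_fun x (v : M x) : radd M N x := (v, 0).
Let inr_fun x (v : N x) : radd M N x := (0, v).
Let fst_fun x (v : radd M N x) : M x := v.1.
Let snd_fun x (v : radd M N x) : N x := v.2.

Let inl_lin x : linear (@inl_fun x).
Proof. by move=> a u v; apply: injective_projections; rewrite /= ?scaler0 ?addr0. Qed.
Let inr_lin x : linear (@inr_fun x).
Proof. by move=> a u v; apply: injective_projections; rewrite /= ?scaler0 ?addr0. Qed.
Let fst_lin x : linear (@fst_fun x). Proof. by []. Qed.
Let snd_lin x : linear (@snd_fun x). Proof. by []. Qed.

HB.instance Definition _ x := GRing.isLinear.Build _ _ _ _ _ (@inl_lin x).
HB.instance Definition _ x := GRing.isLinear.Build _ _ _ _ _ (@inr_lin x).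
HB.instance Definition _ x := GRing.isLinear.Build _ _ _ _ _ (@fst_lin x).
HB.instance Definition _ x := GRing.isLinear.Build _ _ _ _ _ (@snd_lin x).

Let inl_nat x y (xy : (x <= y)%O) (v : M x) :
  rmap (radd M N) xy (inl_fun v) = inl_fun (rmap M xy v).
Proof. by rewrite /= /radd_map /= linear0. Qed.
Let inr_nat x y (xy : (x <= y)%O) (v : N x) :
  rmap (radd M N) xy (inr_fun v) = inr_fun (rmap N xy v).
Proof. by rewrite /= /radd_map /= linear0. Qed.

Definition radd_inl : rhom M (radd M N) := RHom inl_nat.
Definition radd_inr : rhom N (radd M N) := RHom inr_nat.
Definition radd_fst : rhom (radd M N) M :=
  @RHom k d P (radd M N) M (fun x => @fst_fun x) (fun _ _ _ _ => erefl).
Definition radd_snd : rhom (radd M N) N :=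
  @RHom k d P (radd M N) N (fun x => @snd_fun x) (fun _ _ _ _ => erefl).

End Biproduct.

Lemma radd_split M N x (v : radd M N x) :
  v = radd_inl M N x v.1 + radd_inr M N x v.2.
Proof.
by case: v => v w; apply: injective_projections => /=; rewrite ?addr0 ?add0r.
Qed.

(** Only images are compared, which avoids commuting limits and colimits with sums: the two
    inclusions map the product of the images onto the image for the sum, and the two projections
    show that this is injective. *)
Lemma grank_radd M N I : pfd M -> pfd N ->
  grank (radd M N) I = grank M I + grank N I.
Proof.
move=> fM fN; have [m Mm] := pfd_canonical_has_dim I fM.
have [n Nn] := pfd_canonical_has_dim I fN.
have [i1 [i1E i1r]] := rcolim_map I (radd_inl M N).
have [i2 [i2E i2r]] := rcolim_map I (radd_inr M N).
have [p1 [p1E p1r]] := rcolim_map I (radd_fst M N).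
have [p2 [p2E p2r]] := rcolim_map I (radd_snd M N).
pose h (v : (rcolim M I * rcolim N I)%type) := i1 v.1 + i2 v.2.
have hlin : linear h.
  by move=> a u v; rewrite /h !linearP scalerDr addrACA.
pose h' : {linear _ -> _} := HB.pack h (GRing.isLinear.Build _ _ _ _ h hlin).
rewrite (grank_has_dim Mm) (grank_has_dim Nn) -PoszD; apply: grank_has_dim.
have -> : range (@canonical_map k d P (radd M N) I) =
    h' @` (range (@canonical_map k d P M I) `*` range (@canonical_map k d P N I)).
  apply/seteqP; split=> [v Sv|].
    exists (p1 v, p2 v).
      by split; [apply: p1r|apply: p2r]; exists v.
    case: Sv => s _ <-; rewrite /h' /= /h /= /canonical_map p1E p2E i1E i2E.
    by rewrite -linearD -radd_split.
  move=> _ [[u v] [/= Mu Nv] <-]; rewrite /h' /= /h /=.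
  have [_ cD] := range_submod (@canonical_map k d P (radd M N) I).
  rewrite -[i1 u]scale1r; apply: cD; first by apply: i1r; exists u.
  by apply: i2r; exists v.
apply: has_dim_image; last by apply: has_dim_prod => //; exact: range_submod.
  have [M0 MD] := range_submod (@canonical_map k d P M I).
  have [N0 ND] := range_submod (@canonical_map k d P N I).
  by split=> [//|a u v [Mu Nu] [Mv Nv]]; split; [apply: MD|apply: ND].
move=> [u v] [/= [s _ <-] [t _ <-]]; rewrite /h' /= /h /= /canonical_map => e.
congr (_, _).
  have /(congr1 p1) := e; rewrite linear0 linearD i1E i2E !p1E /=.
  by rewrite linear0 addr0.
have /(congr1 p2) := e; rewrite linear0 linearD i1E i2E !p2E /=.
by rewrite linear0 add0r.
Qed.

Section CoordinateSum.
Variable n : nat.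
(** The fibres of [krep] have a dimension that depends on a membership test. The coordinate sum
    embeds both [k^0] and [k^1] into [k] and so avoids casts between them. *)
Definition coord_sum (v : 'rV[k]_n) : k^o := \sum_i v 0 i.
Lemma coord_sum_linear : linear coord_sum.
Proof.
move=> a u v; rewrite /coord_sum scaler_sumr -big_split.
by apply: eq_bigr => i _; rewrite !mxE.
Qed.
HB.instance Definition _ := GRing.isLinear.Build _ _ _ _ _ coord_sum_linear.
End CoordinateSum.

Lemma krep_out J x : ~ iset J x -> forall v : krep k J x, v = 0.
Proof. by move=> Jx; rewrite /krep /= memNset//= => v; apply/rowP => -[]. Qed.

Lemma krep_coord_sum J x y (xy : (x <= y)%O) (v : krep k J x) : iset J y ->
  coord_sum (rmap (krep k J) xy v) = coord_sum v.
Proof.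
move=> Jy; rewrite /coord_sum /= /krep_map.
move: v; rewrite /= (mem_set Jy); case: (x \in _) => v /=.
  by rewrite !big_ord1 mxE big_ord1 mxE mulr1 (ord1 ord0).
by rewrite big_ord1 big_ord0 mxE big_ord0.
Qed.

Lemma coord_sum_eq0 J x (v : krep k J x) : coord_sum v = 0 -> v = 0.
Proof.
rewrite /coord_sum; move: v; rewrite /krep /=; case: (x \in _) => /= v.
  by rewrite big_ord1 => v0; apply/rowP => i; rewrite ord1 v0 mxE.
by move=> _; apply/rowP => -[].
Qed.

Lemma coord_sum_const J x a : iset J x -> coord_sum (const_mx a : krep k J x) = a.
Proof.
move=> Jx; rewrite /coord_sum; under eq_bigr do rewrite mxE.
by rewrite sumr_const card_ord /= (_ : _ \in _ = true)//; apply/mem_set.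
Qed.

Lemma pfd_mx (m : mxrep k P) : pfd (rep_of_mx m).
Proof. by move=> x; apply: fin_dim_rV. Qed.

Lemma grank_krep_sub I J : iset I `<=` iset J -> grank (krep k J) I = 1.
Proof.
move=> IJ; apply: grank_has_dim.
have cE (z : ipoint I) : coord_sum (const_mx 1 : krep k J (val z)) = 1.
  exact/coord_sum_const/IJ/ipointP.
have [|s sE] := @rlim_mk (krep k J) I (fun x => const_mx 1).
  move=> x y xy; apply/eqP; rewrite -subr_eq0; apply/eqP/coord_sum_eq0.
  rewrite linearB; apply/eqP; rewrite subr_eq0; apply/eqP.
  transitivity (coord_sum (const_mx 1 : krep k J (val x))).
    by apply: (krep_coord_sum xy _ (IJ _ (ipointP y))).
  by rewrite [LHS]cE [RHS]cE.
(* The coordinate sums descend to a functional [F] on the colimit. It takes the value 1 on the image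
   of the constant family [s], which is therefore nonzero and will be the basis. *)
have [|F FE] := @rcolim_desc k d P (krep k J) I k^o (fun x => @coord_sum _).
  by move=> x y xy v; apply/krep_coord_sum/IJ/ipointP.
have F1 : F (canonical_map s) = 1.
  by rewrite /canonical_map FE sE; apply: cE.
exists (fun=> canonical_map s); split.
- by move=> i; exists s.
- move=> c; rewrite big_ord1 => /(congr1 F); rewrite linear0 linearZ F1 => e i.
  by rewrite ord1 -[LHS]mulr1.
- move=> _ [t _ <-]; exists (fun=> F (canonical_map t)); rewrite big_ord1.
  have -> : canonical_map t = rcolim_inj (rlim_proj (base_point I) t) by [].
  rewrite -linearZ; congr rcolim_inj; apply/eqP.
  rewrite -subr_eq0; apply/eqP/coord_sum_eq0.
  rewrite linearB linearZ -!FE.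
  rewrite -[rcolim_inj (rlim_proj _ s)]/(canonical_map s) F1.
  by apply/eqP; rewrite subr_eq0 eq_sym; apply/eqP; exact: mulr1.
Qed.

Lemma grank_krep_nsub I J : ~ (iset I `<=` iset J) -> grank (krep k J) I = 0.
Proof.
move=> /existsNP[y /not_implyP[Iy Jy]].
by apply: (grank_eq0 Iy); apply: krep_out.
Qed.

End GeneralizedRank.

(** * Finite presentations *)

Section Presentations.
Variables (k : fieldType) (d : Order.disp_t) (P : porderType d).
Implicit Types (A B M N L : rep k P) (s t : seq P).

(** * Pointwise cokernels and exactness *)

Section Cokernel.
Variables (A B : rep k P) (f : rhom A B).

Let cok x : lmodType k := lquot (range (f x)).

Let cok_map_ex x y (xy : (x <= y)%O) : exists F : {linear cok x -> cok y},
  forall v, F (lquot_pi (range (f x)) v) = lquot_pi (range (f y)) (rmap B xy v).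
Proof.
have [|F FE] := @lquot_desc k (B x) (cok y) (range (f x))
  ((@lquot_pi k (B y) (range (f y)) : {linear B y -> cok y}) \o rmap B xy).
  move=> _ [u _ <-] /=; rewrite rhom_nat -[RHS](linear0 (@lquot_pi k (B y) (range (f y)))).
  by apply/lquot_piP; rewrite subr0; apply: lspan_incl; eexists.
by exists F => v; rewrite FE.
Qed.

Let cok_map x y (xy : (x <= y)%O) := sval (cid (cok_map_ex xy)).

Let cok_mapE x y (xy : (x <= y)%O) v :
  cok_map xy (lquot_pi (range (f x)) v) = lquot_pi (range (f y)) (rmap B xy v).
Proof. exact: (svalP (cid (cok_map_ex xy))). Qed.

Let cok_map_id x (xx : (x <= x)%O) (v : cok x) : cok_map xx v = v.
Proof. by rewrite -(lquot_reprK v) cok_mapE rmap_id. Qed.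

Let cok_map_comp x y z (xy : (x <= y)%O) (yz : (y <= z)%O) (xz : (x <= z)%O)
  (v : cok x) : cok_map yz (cok_map xy v) = cok_map xz v.
Proof. by rewrite -(lquot_reprK v) !cok_mapE rmap_comp. Qed.

Definition rcoker : rep k P := Rep cok_map_id cok_map_comp.

Let pi_nat x y (xy : (x <= y)%O) (v : B x) :
  rmap rcoker xy (lquot_pi (range (f x)) v) = lquot_pi (range (f y)) (rmap B xy v).
Proof. exact: cok_mapE. Qed.

Definition rcoker_pi : rhom B rcoker :=
  @RHom k d P B rcoker (fun x => @lquot_pi k (B x) (range (f x))) pi_nat.

Lemma rcoker_pi_eq0 x v : rcoker_pi x v = 0 <-> range (f x) v.
Proof.
have e : rcoker_pi x v = 0 <-> v - 0 \in lspan (range (f x)).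
  by rewrite -[X in _ = X <-> _](linear0 (rcoker_pi x)); apply: lquot_piP.
apply: iff_trans e _; rewrite subr0; split; last exact: lspan_incl.
by apply: lspan_submod => //; apply: range_submod.
Qed.

End Cokernel.

Definition exact_pair A B M (f : rhom A B) (g : rhom B M) :=
  (forall x v, exists u, g x u = v) /\ (forall x v, g x v = 0 <-> range (f x) v).

Definition rhom0 A B : rhom A B :=
  @RHom k d P A B (fun x => \0) (fun _ _ _ _ => linear0 _).

(** The universal property is tested on pointwise quotients: [rcoker f] detects the kernel of [g],
    and [rcoker g] detects its image. *)
Lemma is_cokernelP A B M (f : rhom A B) (g : rhom B M) :
  is_cokernel f g <-> exact_pair f g.
Proof.
split=> [[gf0 univ]|[gS gf]].
  split=> x v; last first.
    split=> [gv0|[u _ <-]//].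
    have [|u [uE _]] := univ _ (rcoker_pi f).
      by move=> y w; apply/rcoker_pi_eq0; exists w.
    by apply/rcoker_pi_eq0; rewrite -uE gv0 linear0.
  (* The projection [rcoker_pi g] and the zero map both vanish after composition with [g], so
     uniqueness identifies them; thus [g] is surjective. *)
  have [|u [uE uU]] := univ _ (rhom0 B (rcoker g)); first by [].
  have pi0 := uU (rcoker_pi g); have zero0 := uU (rhom0 M (rcoker g)).
  have /rcoker_pi_eq0[w _ <-] : rcoker_pi g x v = 0.
    rewrite pi0 => [|y w]; last by apply/rcoker_pi_eq0; exists w.
    by rewrite -zero0.
  by exists w.
split=> [x v|N h hf0]; first by apply/gf; exists v.
have hg x v w : g x v = g x w -> h x v = h x w.
  move=> /eqP; rewrite -subr_eq0 -linearB => /eqP/gf[u _ fu].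
  by apply/eqP; rewrite -subr_eq0 -linearB -fu hf0.
pose u x v := h x (sval (cid (gS x v))).
have uE x v : u x (g x v) = h x v.
  by rewrite /u; case: cid => w /= /hg.
have ulin x : linear (u x).
  move=> a v w; have [v' <-] := gS x v; have [w' <-] := gS x w.
  by rewrite -linearP !uE linearP.
pose ul x : {linear M x -> N x} := HB.pack (u x) (GRing.isLinear.Build _ _ _ _ _ (ulin x)).
have unat x y (xy : (x <= y)%O) v : rmap N xy (ul x v) = ul y (rmap M xy v).
  by have [w <-] := gS x v; rewrite /= rhom_nat !uE rhom_nat.
exists (@RHom k d P M N ul unat); split=> [x v|u' u'E x v]; first exact: uE.
by have [w <-] := gS x v; rewrite u'E /= uE.
Qed.

Definition rcomp A B M (f : rhom A B) (g : rhom B M) : rhom A M.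
Proof.
refine (@RHom k d P A M (fun x => g x \o f x) _).
by move=> x y xy v /=; rewrite !rhom_nat.
Defined.

Lemma isomorphic_bij M N (f : rhom M N) : (forall x, bijective (f x)) -> isomorphic M N.
Proof.
move=> fB; pose g x := sval (cid (bij_linear_inv (fB x))).
have fK x : cancel (f x) (g x) by have [] := svalP (cid (bij_linear_inv (fB x))).
have gK x : cancel (g x) (f x) by have [] := svalP (cid (bij_linear_inv (fB x))).
have gnat x y (xy : (x <= y)%O) v : rmap M xy (g x v) = g y (rmap N xy v).
  by rewrite -[v in RHS](gK x) rhom_nat fK.
by exists f, (@RHom k d P N M g gnat).
Qed.

Lemma isomorphic_radd M M' N N' : isomorphic M M' -> isomorphic N N' ->
  isomorphic (radd M N) (radd M' N').
Proof.
move=> [f [f' [fK f'K]]] [g [g' [gK g'K]]].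
pose h x (v : radd M N x) : radd M' N' x := (f x v.1, g x v.2).
have hlin x : linear (@h x) by move=> a u v; rewrite /h !linearP.
pose hl x : {linear radd M N x -> radd M' N' x} :=
  HB.pack (@h x) (GRing.isLinear.Build _ _ _ _ _ (hlin x)).
have hnat x y (xy : (x <= y)%O) v :
    rmap (radd M' N') xy (hl x v) = hl y (rmap (radd M N) xy v).
  by rewrite /= /radd_map /h /= !rhom_nat.
apply: (@isomorphic_bij _ _ (RHom hnat)) => x.
exists (fun v => (f' x v.1, g' x v.2)) => -[u v] /=; rewrite /h /=.
  by rewrite fK gK.
by rewrite f'K g'K.
Qed.

Lemma isomorphic_raddA M N L : isomorphic (radd (radd M N) L) (radd M (radd N L)).
Proof.
pose h x (v : radd (radd M N) L x) : radd M (radd N L) x := (v.1.1, (v.1.2, v.2)).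
have hlin x : linear (@h x) by [].
pose hl x : {linear radd (radd M N) L x -> radd M (radd N L) x} :=
  HB.pack (@h x) (GRing.isLinear.Build _ _ _ _ _ (hlin x)).
apply: (@isomorphic_bij _ _ (@RHom k d P _ _ hl (fun _ _ _ _ => erefl))) => x.
by exists (fun v => ((v.1, v.2.1), v.2.2)) => [[[]]|[? []]].
Qed.

Lemma rzero_eq0 x (v : rzero k P x) : v = 0.
Proof. by apply/rowP => -[]. Qed.

Lemma isomorphic_rzero_radd M : isomorphic M (radd (rzero k P) M).
Proof.
apply: (@isomorphic_bij _ _ (radd_inr (rzero k P) M)) => x.
by exists snd => [//|[u v]]; rewrite (rzero_eq0 u).
Qed.

Lemma free_rep_cat s t :
  isomorphic (free_rep k (s ++ t)) (radd (free_rep k s) (free_rep k t)).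
Proof.
elim: s => [|x s IHs] /=; first exact: isomorphic_rzero_radd.
apply: isomorphic_trans (isomorphic_sym (isomorphic_raddA _ _ _)).
exact: isomorphic_radd (isomorphic_refl _) IHs.
Qed.

Lemma pfd_free s : pfd (free_rep k s).
Proof. by elim: s => [|x s IHs]; [exact: pfd_mx|apply: pfd_radd => //; apply: pfd_mx]. Qed.

Lemma fp_pfd M : fpresentable M -> pfd M.
Proof.
move=> [s [t [f [g /is_cokernelP[gS _]]]]] x.
exact: fin_dim_surj (gS x) (pfd_free t x).
Qed.

Lemma fp_iso M N : isomorphic M N -> fpresentable M -> fpresentable N.
Proof.
move=> [i [j [iK jK]]] [s [t [f [g /is_cokernelP[gS gf]]]]].
exists s, t, f, (rcomp g i); apply/is_cokernelP; split=> x v /=.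
  by have [u gu] := gS x (j x v); exists u; rewrite gu jK.
split=> [/(congr1 (j x))|/gf ->]; last exact: linear0.
by rewrite iK linear0 => /gf.
Qed.

Lemma exact_pair_radd A B M A' B' M' (f : rhom A B) (g : rhom B M)
    (f' : rhom A' B') (g' : rhom B' M') :
  exact_pair f g -> exact_pair f' g' ->
  exists (h : rhom (radd A A') (radd B B')) (l : rhom (radd B B') (radd M M')),
    exact_pair h l.
Proof.
have sum (X Y X' Y' : rep k P) (u : rhom X Y) (u' : rhom X' Y') :
    exists h : rhom (radd X X') (radd Y Y'), forall x v, h x v = (u x v.1, u' x v.2).
  pose h x (v : radd X X' x) : radd Y Y' x := (u x v.1, u' x v.2).
  have hlin x : linear (@h x) by move=> a v w; rewrite /h !linearP.
  pose hl x : {linear radd X X' x -> radd Y Y' x} :=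
    HB.pack (@h x) (GRing.isLinear.Build _ _ _ _ _ (hlin x)).
  have hnat x y (xy : (x <= y)%O) v :
      rmap (radd Y Y') xy (hl x v) = hl y (rmap (radd X X') xy v).
    by rewrite /= /radd_map /h /= !rhom_nat.
  by exists (RHom hnat).
move=> [gS gf] [gS' gf']; have [h hE] := sum _ _ _ _ f f'.
have [l lE] := sum _ _ _ _ g g'; exists h, l; split=> x [v v'].
  by have [u <-] := gS x v; have [u' <-] := gS' x v'; exists (u, u'); rewrite lE.
rewrite lE; split=> [[/gf[u _ /= <-] /gf'[u' _ /= <-]]|].
  by exists (u, u'); rewrite ?hE.
move=> [[u u'] _]; rewrite hE => -[<- <-] /=.
by congr (_, _); [apply/gf; exists u|apply/gf'; exists u'].
Qed.

Lemma exact_pair_iso A B M A' B' (i : rhom A' A) (j : rhom B B') (j' : rhom B' B)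
    (f : rhom A B) (g : rhom B M) :
  (forall x v, exists u, i x u = v) ->
  (forall x, cancel (j x) (j' x)) -> (forall x, cancel (j' x) (j x)) ->
  exact_pair f g -> exact_pair (rcomp i (rcomp f j)) (rcomp j' g).
Proof.
move=> iS jK j'K [gS gf]; split=> x v /=.
  by have [u gu] := gS x v; exists (j x u); rewrite jK.
split=> [/gf[u _ fu]|[u _ <-]]; last by rewrite jK; apply/gf; exists (i x u).
by have [w wE] := iS x u; exists w => //=; rewrite wE fu j'K.
Qed.

Lemma fp_radd M N : fpresentable M -> fpresentable N -> fpresentable (radd M N).
Proof.
move=> [s [t [f [g /is_cokernelP fg]]]] [s' [t' [f' [g' /is_cokernelP fg']]]].
have [h [l hl]] := exact_pair_radd fg fg'.
have [i [i' [_ i'K]]] := free_rep_cat s s'.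
have [j [j' [jK j'K]]] := isomorphic_sym (free_rep_cat t t').
exists (s ++ s'), (t ++ t'), (rcomp i (rcomp h j)), (rcomp j' l).
apply/is_cokernelP; apply: exact_pair_iso => // x v.
by exists (i' x v); rewrite i'K.
Qed.

Lemma fp_rzero : fpresentable (rzero k P).
Proof.
exists [::], [::], (rhom0 _ _), (@RHom k d P _ _ (fun=> idfun) (fun _ _ _ _ => erefl)).
apply/is_cokernelP; split=> x v /=; first by exists v.
by rewrite (rzero_eq0 v); split=> // _; exists 0.
Qed.

(** Isomorphism classes are built from coordinate models, so each finitely presentable
    representation needs one to have a class. Chosen bases of all fibres turn the structure maps
    into matrices acting on row vectors. *)
Lemma mx_model M : pfd M -> exists m : mxrep k P, isomorphic (rep_of_mx m) M.
Proof.
move=> fM.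
have ex x : exists nb : {n & 'I_n -> M x}, is_basis [set: M x] (projT2 nb).
  by have [n [b bb]] := fin_dim_basis (fM x); exists (existT _ n b).
pose n x := projT1 (sval (cid (ex x))).
pose b x : 'I_(n x) -> M x := projT2 (sval (cid (ex x))).
have bP x : is_basis [set: M x] (b x) by exact: (svalP (cid (ex x))).
pose e x (v : 'rV[k]_(n x)) : M x := \sum_i v 0 i *: b x i.
have elin x : linear (@e x).
  move=> a u v; rewrite /e scaler_sumr -big_split; apply: eq_bigr => i _.
  by rewrite !mxE scalerDl scalerA.
pose el x : {linear 'rV[k]_(n x) -> M x} :=
  HB.pack (@e x) (GRing.isLinear.Build _ _ _ _ _ (elin x)).
have ebij x : bijective (el x).
  have [_ fb sb] := bP x; apply: inj_surj_bij => [u v|v].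
    move=> /eqP; rewrite -subr_eq0 -linearB => /eqP /fb h.
    by apply/eqP; rewrite -subr_eq0; apply/eqP/rowP => i; rewrite h mxE.
  have [//|c ->] := sb v; exists (\row_i c i).
  by apply: eq_bigr => i _; rewrite mxE.
pose e' x := sval (cid (bij_linear_inv (ebij x))).
have eK x : cancel (el x) (e' x) by have [] := svalP (cid (bij_linear_inv (ebij x))).
have e'K x : cancel (e' x) (el x) by have [] := svalP (cid (bij_linear_inv (ebij x))).
pose A x y (xy : (x <= y)%O) : 'M[k]_(n x, n y) := lin1_mx (e' y \o (rmap M xy \o el x)).
have AE x y (xy : (x <= y)%O) v : v *m A x y xy = e' y (rmap M xy (el x v)).
  by rewrite mul_rV_lin1.
have A1 x (xx : (x <= x)%O) : A x x xx = 1%:M.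
  by apply/row_matrixP => i; rewrite !rowE AE rmap_id eK mulmx1.
have AC x y z (xy : (x <= y)%O) (yz : (y <= z)%O) (xz : (x <= z)%O) :
    A x y xy *m A y z yz = A x z xz.
  by apply/row_matrixP => i; rewrite !rowE mulmxA !AE e'K (rmap_comp _ _ xz).
exists (MxRep A1 AC).
have enat x y (xy : (x <= y)%O) (v : rep_of_mx (MxRep A1 AC) x) :
    rmap M xy (el x v) = el y (rmap (rep_of_mx (MxRep A1 AC)) xy v).
  transitivity (el y (e' y (rmap M xy (el x v)))); first by rewrite e'K.
  by rewrite -AE.
exact: (@isomorphic_bij _ _ (@RHom k d P (rep_of_mx (MxRep A1 AC)) M el enat)).
Qed.

End Presentations.

(** * Grids *)

Section Grids.
Variables (d : Order.disp_t) (P : porderType d).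

(* [G] is the grid and [q x y] means that every grid coordinate below [x] is
   below [y]. The points [h] in [grid_down] and [grid_up] lie in the [q]-hull of
   [I]; in a finite poset, where [q] is [<=], connectedness needs this. *)
Record is_grid (q : rel P) (G : seq P) : Prop := IsGrid {
  grid_le : forall x y, (x <= y)%O -> q x y;
  grid_trans : forall y x z, q x y -> q y z -> q x z;
  grid_good : forall g y, g \in G -> q g y -> (g <= y)%O;
  grid_floor : forall g x, g \in G -> (g <= x)%O ->
    exists2 g', g' \in G & (g' <= x)%O && q x g';
  grid_lower : forall x h, q x h -> exists w, [/\ (w <= x)%O, (w <= h)%O & q x w];
  grid_down : forall (I : pinterval P) h z x y, iset I z -> q h z -> iset I x -> iset I y ->
    q x h -> q y h -> linked ([set p | iset I p /\ q p h]) x y;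
  grid_up : forall (I : pinterval P) h z x y, iset I z -> q z h -> iset I x -> iset I y ->
    q h x -> q h y -> linked ([set p | iset I p /\ q h p]) x y;
  grid_fin : exists (T : finType) (sigma : P -> T),
    forall x y, sigma x = sigma y -> q x y }.

End Grids.

Section Tame.
Variables (k : fieldType) (d : Order.disp_t) (P : porderType d).
Variables (q : rel P) (G : seq P).
Hypothesis qG : is_grid q G.
Implicit Types (A B M N : rep k P) (s t : seq P) (J : pinterval P).

Definition supported x := exists2 g, g \in G & (g <= x)%O.

(* Equivalently, [M] is determined by its restriction to [G], by left Kan
   extension. *)
Definition tame M :=
  (forall x, ~ supported x -> forall v : M x, v = 0) /\
  (forall g x (gx : (g <= x)%O), g \in G -> q x g -> bijective (rmap M gx)).

Lemma krep_bij J x y (xy : (x <= y)%O) : (iset J x <-> iset J y) -> bijective (rmap (krep k J) xy).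
Proof.
move=> Jxy; have [Jy|nJy] := pselect (iset J y); last first.
  have nJx : ~ iset J x by move=> /Jxy.
  exists (fun=> 0) => v; first by rewrite [RHS](krep_out nJx).
  by rewrite [RHS](krep_out nJy) [LHS](krep_out nJy).
apply: inj_surj_bij => [|v].
  apply: ker0_inj => u u0; apply: coord_sum_eq0.
  by apply: etrans (esym (krep_coord_sum xy u Jy)) _; rewrite u0 linear0.
exists (const_mx (coord_sum v) : krep k J x).
apply/eqP; rewrite -subr_eq0; apply/eqP/coord_sum_eq0.
rewrite linearB; apply/eqP; rewrite subr_eq0; apply/eqP.
apply: etrans (krep_coord_sum xy _ Jy) _.
by apply: coord_sum_const; apply/Jxy.
Qed.

Lemma tame_krep J : (forall x, iset J x -> supported x) ->
  (forall x y, q x y -> q y x -> iset J x -> iset J y) -> tame (krep k J).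
Proof.
move=> Js Jq; split=> [x xs|g x gx Gg xg]; first by apply: krep_out => /Js.
by apply: krep_bij; split; apply: Jq => //; apply: (grid_le qG gx).
Qed.

(** By [grid_good], the up-set of a grid point is closed under [q], so it contains [x] exactly when
    it contains a grid point below [x] that is equivalent to [x]. *)
Lemma tame_up g : g \in G -> tame (krep k (up g)).
Proof.
move=> Gg; apply: tame_krep => [x /= gx|x y xy _ /= gx]; first by exists g.
by apply: (grid_good qG Gg); apply: (grid_trans qG _ xy); apply: (grid_le qG gx).
Qed.

Lemma tame_radd M N : tame M -> tame N -> tame (radd M N).
Proof.
move=> [M0 Mb] [N0 Nb]; split=> [x xs [u v]|g x gx Gg xg].
  by rewrite (M0 _ xs u) (N0 _ xs v).
have [f fK Kf] := Mb _ _ gx Gg xg; have [h hK Kh] := Nb _ _ gx Gg xg.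
exists (fun v => (f v.1, h v.2)) => -[u v]; rewrite /= /radd_map /=.
  by rewrite fK hK.
by rewrite Kf Kh.
Qed.

Lemma tame_free s : {subset s <= G} -> tame (free_rep k s).
Proof.
elim: s => [_|g s IHs sG].
  split=> [x _ v|g x gx _ _]; first exact: rzero_eq0.
  by exists (fun=> 0) => v; rewrite [RHS]rzero_eq0 [LHS]rzero_eq0.
apply: tame_radd; first by apply: tame_up; apply: sG; rewrite mem_head.
by apply: IHs => x xs; apply: sG; rewrite inE xs orbT.
Qed.

(** A four lemma: surjectivity passes down from [B], and injectivity follows from surjectivity for
    [A] together with injectivity for [B]. *)
Lemma tame_exact_pair A B M (f : rhom A B) (g : rhom B M) :
  exact_pair f g -> tame A -> tame B -> tame M.
Proof.
move=> [gS gf] [_ Ab] [B0 Bb]; split=> [x xs v|p x px Gp xp].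
  by have [u <-] := gS x v; rewrite (B0 _ xs u) linear0.
have [f' _ f'K] := Ab _ _ px Gp xp; have Bi := bij_inj (Bb _ _ px Gp xp).
have [g' _ g'K] := Bb _ _ px Gp xp.
apply: inj_surj_bij => [|v]; last first.
  by have [u <-] := gS x v; exists (g p (g' u)); rewrite rhom_nat g'K.
apply: ker0_inj => u; have [w <-] := gS p u.
rewrite rhom_nat => /gf[a _ fa]; apply/gf; exists (f' a) => //.
by apply: Bi; rewrite rhom_nat f'K.
Qed.

(** * Subrepresentations generated at grid points *)

Section Generation.
Variables (N : rep k P) (K : forall x, set (N x)).
Hypothesis Ksub : forall x, is_submod (@K x).
Hypothesis Kmap : forall x y (xy : (x <= y)%O) v, K v -> K (rmap N xy v).

(** The Yoneda map sending the generator at [g] to [v]. The default 0 is used only where the fibre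
    of [krep k (up g)] is zero. *)
Definition gen_fun g (v : N g) x (w : krep k (up g) x) : N x :=
  coord_sum w *: (if pselect (g <= x)%O is left gx then rmap N gx v else 0).

Lemma gen_linear g (v : N g) x : linear (@gen_fun g v x).
Proof. by move=> a u w; rewrite /gen_fun linearP scalerDl scalerA. Qed.

HB.instance Definition _ g v x := GRing.isLinear.Build _ _ _ _ _ (@gen_linear g v x).

Lemma gen_nat g (v : N g) x y (xy : (x <= y)%O) (w : krep k (up g) x) :
  rmap N xy (gen_fun v w) = gen_fun v (rmap (krep k (up g)) xy w).
Proof.
have [gx|ngx] := pselect (g <= x)%O; last first.
  have -> : w = 0 by apply: krep_out.
  by rewrite !linear0.
rewrite /gen_fun linearZ; case: pselect => // gx'.
have gy := le_trans gx xy; rewrite krep_coord_sum//.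
by case: pselect => // gy'; rewrite [in LHS]/= (rmap_comp gx' xy gy').
Qed.

Definition gen g (v : N g) : rhom (krep k (up g)) N := RHom (gen_nat v).

Lemma rcopair A B (f : rhom A N) (h : rhom B N) :
  exists l : rhom (radd A B) N, forall x v, l x v = f x v.1 + h x v.2.
Proof.
pose l x (v : radd A B x) : N x := f x v.1 + h x v.2.
have llin x : linear (@l x) by move=> a u v; rewrite /l !linearP scalerDr addrACA.
pose ll x : {linear radd A B x -> N x} :=
  HB.pack (@l x) (GRing.isLinear.Build _ _ _ _ _ (llin x)).
have lnat x y (xy : (x <= y)%O) v : rmap N xy (ll x v) = ll y (rmap (radd A B) xy v).
  by rewrite /= /l linearD !rhom_nat.
by exists (RHom lnat).
Qed.

Definition within t (f : rhom (free_rep k t) N) :=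
  {subset t <= G} /\ forall x, range (f x) `<=` @K x.

(** Each vector of [l] adds one copy of the up-set representation of [g]; the images already reached
    are kept. *)
Lemma generate_list g (l : seq (N g)) t (f : rhom (free_rep k t) N) : g \in G ->
  (forall v, v \in l -> K v) -> within f ->
  exists t' (f' : rhom (free_rep k t') N), [/\ within f',
    forall x, range (f x) `<=` range (f' x) &
    forall v, v \in l -> forall x (gx : (g <= x)%O), range (f' x) (rmap N gx v)].
Proof.
move=> Gg; elim: l => [|v l IHl] Kl fw; first by exists t, f; split=> // x u.
have [|//|t' [f' [[tG fK] ff' f'l]]] := IHl.
  by move=> w wl; apply: Kl; rewrite inE wl orbT.
have [h hE] := rcopair (gen v) f'.
exists (g :: t'), h; split.
- split=> [x|x _ [[u w] _ <-]]; first by rewrite inE => /predU1P[->|/tG].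
  rewrite hE; have [_ KD] := Ksub x; rewrite /= /gen_fun; apply: KD; last first.
    by apply: fK; exists w.
  by case: pselect => gx; [apply/Kmap/Kl/mem_head|have [] := Ksub x].
- move=> x _ /ff'[w _ <-]; exists (0, w); rewrite // hE /= linear0 add0r//.
- move=> w; rewrite inE => /predU1P[->|/f'l wl] x gx.
    exists (const_mx 1 : krep k (up g) x, 0) => //; rewrite hE /= linear0 addr0 /gen_fun.
    rewrite (_ : coord_sum _ = 1); last exact: (@coord_sum_const k d P (up g)).
    by rewrite scale1r; case: pselect => // gx'; congr (rmap N _ v); apply: Prop_irrelevance.
  by have [u _ <-] := wl _ gx; exists (0, u); rewrite // hE /= linear0 add0r.
Qed.

(** Used twice to build a presentation: with all of [N] to find generators, and with the kernel of
    the resulting cover to find relations. *)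
Lemma generate_subrep :
  (forall g, g \in G -> exists n, has_dim (@K g) n) ->
  (forall x v, K v -> v = 0 \/
     exists g (gx : (g <= x)%O) w, [/\ g \in G, K w & v = rmap N gx w]) ->
  exists t (f : rhom (free_rep k t) N),
    {subset t <= G} /\ forall x, range (f x) = @K x.
Proof.
move=> Kfin Kgen.
suff [t [f [[tG fK] fG]]] : exists t (f : rhom (free_rep k t) N), within f /\
    forall g x (gx : (g <= x)%O) v, g \in G -> K v -> range (f x) (rmap N gx v).
  exists t, f; split=> // x; apply/seteqP; split=> [|v Kv]; first exact: fK.
  have [->|[g [gx [w [Gg Kw ->]]]]] := Kgen x v Kv; last exact: fG.
  exact: (range_submod (f x)).1.
have : forall G' : seq P, {subset G' <= G} ->
    exists t (f : rhom (free_rep k t) N), within f /\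
    forall g x (gx : (g <= x)%O) v, g \in G' -> K v -> range (f x) (rmap N gx v).
  elim=> [_|g G' IH GG'].
    exists [::], (rhom0 _ _); split=> //; split=> // x _ [u _ <-].
    by have [] := Ksub x.
  have [|t [f [fw fG']]] := IH; first by move=> x xG; apply: GG'; rewrite inE xG orbT.
  have Gg : g \in G by apply: GG'; rewrite mem_head.
  have [n [b [Kb _ sb]]] := Kfin g Gg.
  have [|t' [f' [f'w ff' f'b]]] := @generate_list g (codom b) t f Gg _ fw.
    by move=> _ /codomP[i ->].
  exists t', f'; split=> // p x px v; rewrite inE => /predU1P[pg|pG'] Kv; last first.
    by apply/ff'/fG'.
  subst p; have [c ->] := sb v Kv; rewrite linear_sum.
  under eq_bigr do rewrite linearZ.
  by apply: submod_sum => [|i]; [exact: range_submod|apply: f'b; apply: codom_f].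
by apply.
Qed.

End Generation.

(** The clause [q x g] is recorded because it makes the map from [g] to [x] bijective on every other
    tame representation as well. *)
Lemma tame_lift N x (v : N x) : tame N -> v = 0 \/
  exists g (gx : (g <= x)%O) w, [/\ g \in G, q x g & v = rmap N gx w].
Proof.
move=> [N0 Nb]; have [[g Gg gx]|xs] := pselect (supported x); last by left; apply: N0.
right; have [g' Gg' /andP[gx' xg']] := grid_floor qG Gg gx.
have [r _ rK] := Nb _ _ gx' Gg' xg'.
by exists g', gx', (r v); rewrite rK.
Qed.

Lemma tame_fp N : tame N -> pfd N -> fpresentable N.
Proof.
move=> tN fN.
have [||||t [g [tG gS]]] := @generate_subrep N (fun x => setT).
- by [].
- by [].
- by move=> p _; apply: fin_dim_basis.
- move=> x v _; have [->|[p [px [w [Gp _ ->]]]]] := tame_lift v tN; first by left.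
  by right; exists p, px, w.
have tt := tame_free tG.
have [||||s [f [sG fE]]] := @generate_subrep (free_rep k t) (fun x => [set v | g x v = 0]).
- move=> x; split=> [|a u v /= gu gv]; first exact: linear0.
  by rewrite linearP gu gv scaler0 addr0.
- by move=> x y xy v /= gv; rewrite -rhom_nat gv linear0.
- move=> p _; have [n [e eS]] := pfd_free k t p.
  apply: (@submod_has_dim _ _ _ n e) => [|v _]; last exact: eS.
  split=> [|a u v /= gu gv]; first exact: linear0.
  by rewrite linearP gu gv scaler0 addr0.
- move=> x v /= gv; have [->|[p [px [w [Gp xp vE]]]]] := tame_lift v tt; first by left.
  (* The lift [w] of a kernel vector is again in the kernel, because [N] maps the fibre at [p]
     injectively to the fibre at [x]. *)
  right; exists p, px, w; split=> //.
  apply: (bij_inj (tN.2 _ _ px Gp xp)).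
  by rewrite rhom_nat -vE gv linear0.
exists s, t, f, g; apply/is_cokernelP; split=> x v; last by rewrite fE.
by have [u _ <-] : range (g x) v; [rewrite gS|exists u].
Qed.

End Tame.

(** * Hulls and Moebius inversion *)

Section Moebius.
Variables (T : eqType) (le : T -> T -> Prop).
Hypothesis le_refl : forall x, le x x.
Hypothesis le_trans : forall y x z, le x y -> le y z -> le x z.
Hypothesis le_anti : forall x y, le x y -> le y x -> x = y.

Lemma minimal_in (a : T) (L : seq T) : exists2 m, m \in a :: L &
  forall y, y \in a :: L -> le y m -> y = m.
Proof.
elim: L => [|b L [m mL mP]].
  by exists a; rewrite ?mem_head// => y; rewrite inE => /eqP.
have [bm|nbm] := pselect (le b m).
  exists b; first by rewrite !inE eqxx orbT.
  move=> y; rewrite !inE orbCA => /predU1P[//|yL] yb.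
  have ym : y = m by apply: mP; [rewrite inE|exact: le_trans bm].
  by apply: le_anti => //; rewrite ym.
exists m; first by move: mL; rewrite !inE => /orP[]->; rewrite ?orbT.
by move=> y; rewrite !inE orbCA => /predU1P[->//|yL]; apply: mP; rewrite inE.
Qed.

(** Induction on the size, removing a minimal [m]: the value at [m] enters no equation but its own,
    so it can be chosen last to satisfy that one. *)
Lemma moebius_exists (L : seq T) (r : T -> int) : uniq L ->
  exists d : T -> int, (forall x, x \notin L -> d x = 0) /\
    forall x, x \in L -> r x = \sum_(y <- L | `[< le x y >]) d y.
Proof.
move: {2}(size L) (erefl (size L)) => n; elim: n L => [|n IHn] L.
  by move=> /size0nil -> _; exists (fun=> 0).
case: L => // a L' sL uL; set L := a :: L' in sL uL *.
have [m mL mP] := minimal_in a L'.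
have [||d [d0 dP]] := IHn (rem m L).
- by rewrite size_rem// sL.
- exact: rem_uniq.
have dm : d m = 0 by apply: d0; rewrite mem_rem_uniq// inE eqxx.
pose s := \sum_(y <- rem m L | `[< le m y >]) d y.
pose d' x := if x == m then r m - s else d x.
have sumE x : \sum_(y <- rem m L | `[< le x y >]) d' y =
    \sum_(y <- rem m L | `[< le x y >]) d y.
  rewrite big_seq_cond [RHS]big_seq_cond; apply: eq_bigr => y.
  by rewrite mem_rem_uniq// inE /d' => /andP[/andP[/negbTE ->]].
exists d'; split=> [x xL|x xL].
  rewrite /d' ifN; last by apply: contraNneq xL => ->.
  by apply: d0; apply: contra xL => /mem_rem.
rewrite (perm_big _ (perm_to_rem mL)) big_cons sumE.
case: ifPn => [/asboolP xm|/asboolPn xm].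
  by rewrite (mP x xL xm) /d' eqxx -[RHS]/(r m - s + s) subrK.
apply: dP; rewrite mem_rem_uniq// inE xL andbT.
by apply/eqP => e; apply: xm; rewrite e.
Qed.

End Moebius.

(** * Hulls for the grid preorder *)

Section Hull.
Variables (d : Order.disp_t) (P : porderType d) (q : rel P) (G : seq P).
Hypothesis qG : is_grid q G.
Implicit Types (I J : pinterval P).

Lemma gridxx x : q x x. Proof. exact: (grid_le qG (lexx x)). Qed.

Definition hull_set I : set P :=
  [set h | exists x z, [/\ iset I x, iset I z, q x h & q h z]].

Lemma sub_hull I : iset I `<=` hull_set I.
Proof. by move=> x Ix; exists x, x; split=> //; apply: gridxx. Qed.

Lemma linked_sym (A : set P) x y : A x -> linked A x y -> linked A y x.
Proof.
move=> Ax Axy; apply: (@linked_ind _ _ A (fun z => linked A z x) _ x y Ax Axy).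
  move=> p r Ap Ar pr px; apply: linked_trans px; apply: linked1 => //.
  by rewrite comparable_sym.
exact: linked_refl.
Qed.

Lemma hull_interval I : is_interval (hull_set I).
Proof.
split.
- by have [[x Ix] _ _] := pintervalP I; exists x; apply: sub_hull.
- have down h : hull_set I h -> exists2 x, iset I x & linked (hull_set I) h x.
    move=> [x [z [Ix Iz xh hz]]]; exists x => //.
    (* The point [w] bridges [h] and [x] from below. It stays in the hull since [q x w] and [w] is
       below [x]. *)
    have [w [wx wh xw]] := grid_lower qG xh.
    have Hw : hull_set I w.
      by exists x, x; split=> //; apply: (grid_le qG).
    apply: (@linked_trans _ _ _ _ w); first by apply: linked1; rewrite // /Order.comparable wh orbT.
    by apply: linked1; [exact: sub_hull|rewrite /Order.comparable wx].
  move=> h h' Hh Hh'; have [x Ix hx] := down h Hh; have [x' Ix' hx'] := down h' Hh'.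
  have : linked (hull_set I) h h'; last by [].
  apply: linked_trans hx _; apply: linked_trans (linked_sym Hh' hx').
  by apply: linked_sub (interval_linked Ix Ix'); apply: sub_hull.
- move=> x y z [a [b [Ia Ib ax xb]]] [a' [b' [Ia' Ib' az zb]]] xy yz.
  exists a, b'; split=> //; first by apply: (grid_trans qG ax); apply: (grid_le qG).
  by apply: (grid_trans qG _ zb); apply: (grid_le qG).
Qed.

Definition hull I : pinterval P := PInterval (hull_interval I).

Definition grid_closed J :=
  forall x z h, iset J x -> iset J z -> q x h -> q h z -> iset J h.

Lemma hull_closed I : grid_closed (hull I).
Proof.
move=> x z h [a [_ [Ia _ ax _]]] [_ [b [_ Ib _ zb]]] xh hz; exists a, b; split=> //.
  exact: (grid_trans qG ax).
exact: (grid_trans qG _ zb).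
Qed.

Lemma hull_sub I J : grid_closed J -> iset I `<=` iset J -> iset (hull I) `<=` iset J.
Proof. by move=> cJ IJ h [a [b [Ia Ib ah hb]]]; apply: cJ ah hb; apply: IJ. Qed.

(** A closed interval is a union of classes of [q], hence determined by the set of its
    [sigma]-values, and there are finitely many such sets. *)
Lemma closed_intervals : exists L : seq (pinterval P),
  forall J, grid_closed J -> J \in L.
Proof.
have [T [sigma sigmaP]] := grid_fin qG.
pose f J : {set T} := [set t | `[< exists2 x, iset J x & sigma x = t >]]%SET.
have finj J J' : grid_closed J -> grid_closed J' -> f J = f J' -> iset J `<=` iset J'.
  move=> cJ cJ' e x Jx; have : sigma x \in f J by rewrite inE; apply/asboolP; exists x.
  rewrite e inE => /asboolP[y Jy yx].
  by apply: (cJ' y y) => //; apply: sigmaP.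
pose g (A : {set T}) := if pselect (exists2 J, grid_closed J & f J = A) is left h
  then Some (s2val (cid2 h)) else None.
exists (pmap g (enum {set T})) => J cJ.
rewrite mem_pmap; apply/mapP; exists (f J); rewrite ?mem_enum// /g.
case: pselect => [h|[]]; last by exists J.
congr Some; case: (cid2 h) => J' cJ' e /=; apply: pinterval_eq.
by apply/seteqP; split; apply: finj.
Qed.

End Hull.

(** * Extension along the grid preorder and invariance of the rank *)

Section Extension.
Variables (k : fieldType) (d : Order.disp_t) (P : porderType d).
Variables (q : rel P) (G : seq P).
Hypothesis qG : is_grid q G.
Variable M : rep k P.
Hypothesis tM : tame q G M.

(** To go from [x] to [y], invert the bijection from the largest grid point [g] below [x], then map
    from [g] to [y]. At a point above no grid point the fibre is zero, and so is the map. *)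
Lemma tame_ext : exists t : forall x y, q x y -> {linear M x -> M y},
  (forall x y (xy : (x <= y)%O) (qxy : q x y) v, t x y qxy v = rmap M xy v) /\
  (forall x y z (xy : q x y) (yz : q y z) (xz : q x z) v,
     t y z yz (t x y xy v) = t x z xz v).
Proof.
have ex x y (xy : q x y) : exists F : {linear M x -> M y},
    forall g (gx : (g <= x)%O) (gy : (g <= y)%O) u, g \in G -> q x g ->
      F (rmap M gx u) = rmap M gy u.
  have [[g [gx [Gg xg]]]|nx] :=
      pselect (exists g, exists _ : (g <= x)%O, g \in G /\ q x g).
    have [r [rK Kr]] := bij_linear_inv (tM.2 g x gx Gg xg).
    have gy : (g <= y)%O.
      by apply: (grid_good qG Gg); apply: (grid_trans qG _ xy); apply: (grid_le qG).
    exists (rmap M gy \o r) => g' gx' gy' u Gg' xg'.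
    (* Two grid points below [x] and equivalent to it are equal by [grid_good], so the construction
       does not depend on the choice. *)
    have gg' : g' = g.
      apply/le_anti/andP; split.
        by apply: (grid_good qG Gg'); apply: (grid_trans qG _ xg); apply: (grid_le qG).
      by apply: (grid_good qG Gg); apply: (grid_trans qG _ xg'); apply: (grid_le qG).
    subst g'; rewrite (Prop_irrelevance gx' gx) (Prop_irrelevance gy' gy) /=.
    by rewrite rK.
  by exists \0 => g gx gy u Gg xg; case: nx; exists g, gx.
pose t x y (xy : q x y) := sval (cid (ex x y xy)).
have tE x y (xy : q x y) g (gx : (g <= x)%O) (gy : (g <= y)%O) u : g \in G -> q x g ->
    t x y xy (rmap M gx u) = rmap M gy u.
  by move=> Gg xg; rewrite /t (svalP (cid (ex x y xy)) g gx gy).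
have gle x y g : (g <= x)%O -> g \in G -> q x y -> (g <= y)%O.
  by move=> gx Gg xy; apply: (grid_good qG Gg); apply: (grid_trans qG _ xy); apply: (grid_le qG).
exists t; split=> [x y xy qxy v|x y z xy yz xz v].
  have [->|[g [gx [w [Gg xg ->]]]]] := tame_lift qG v tM; first by rewrite !linear0.
  by rewrite (tE _ _ _ _ _ (le_trans gx xy))// (rmap_comp gx xy (le_trans gx xy)).
have [->|[g [gx [w [Gg xg ->]]]]] := tame_lift qG v tM; first by rewrite !linear0.
have gy := gle _ _ _ gx Gg xy; have gz := gle _ _ _ gx Gg xz.
rewrite (tE x y xy g gx gy)// (tE x z xz g gx gz)//.
(* The floor [g'] of [y] lies above [g], so the detour through [y] can be computed along [g], [g'],
   [z] with honest structure maps. *)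
have [g' Gg' /andP[gy' yg']] := grid_floor qG Gg gy.
have gg' : (g <= g')%O by apply: (gle y).
rewrite -(rmap_comp gg' gy' gy) (tE y z yz g' gy' (gle _ _ _ gy' Gg' yz))//.
by rewrite (rmap_comp gg' _ gz).
Qed.

Hypothesis fM : pfd M.

(** The inclusion induces [phi] from the colimit over [I] to the colimit over the hull. It maps one
    image of the canonical map onto the other, and [psi] witnesses that it is injective there. *)
Lemma grank_hull (I : pinterval P) : grank M I = grank M (hull qG I).
Proof.
have [t [tE tC]] := tame_ext; set C := hull qG I.
have inC x : iset I x -> iset C x by apply: (sub_hull qG).
pose inc (x : ipoint I) : ipoint C := mkpoint (inC _ (ipointP x)).
(* Carrying a compatible family to [h] gives the same vector from every point of [I] below [h] for
   [q]; [grid_down] connects these points. *)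
have down (s : rlim M I) h z (x y : ipoint I) (xh : q (val x) h) (yh : q (val y) h) :
    iset I z -> q h z -> t _ _ xh (rlim_proj x s) = t _ _ yh (rlim_proj y s).
  move=> Iz hz.
  pose Q p := forall (w : ipoint I) (wh : q (val w) h), val w = p ->
    t _ _ wh (rlim_proj w s) = t _ _ xh (rlim_proj x s).
  suff Qy : Q (val y) by rewrite (Qy y yh).
  apply: (@linked_ind _ _ [set p | iset I p /\ q p h] Q _ (val x)).
  - move=> a b [Ia ah] [Ib bh] ab Qa w wh wb; subst b.
    rewrite -(Qa (mkpoint Ia) ah erefl); case/orP: ab => [aw|wa].
      rewrite -(rlim_proj_nat (x := mkpoint Ia) (y := w) aw).
      by rewrite -(tE _ _ aw (grid_le qG aw)) tC.
    rewrite -(rlim_proj_nat (x := w) (y := mkpoint Ia) wa).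
    by rewrite -(tE _ _ wa (grid_le qG wa)) tC.
  - by split; [exact: ipointP|].
  - by apply: (grid_down qG Iz) => //; apply: ipointP.
  - move=> w wh /val_inj wx; subst w.
    by congr (t _ _ _ _); apply: Prop_irrelevance.
(* Dually, a vector at [h] has the same class in the colimit wherever it is pushed to a point of [I]
   above [h]. *)
have up h z (x y : ipoint I) (hx : q h (val x)) (hy : q h (val y)) (v : M h) :
    iset I z -> q z h -> rcolim_inj (x := x) (t _ _ hx v) = rcolim_inj (x := y) (t _ _ hy v).
  move=> Iz zh.
  pose Q p := forall (w : ipoint I) (hw : q h (val w)), val w = p ->
    rcolim_inj (x := w) (t _ _ hw v) = rcolim_inj (x := x) (t _ _ hx v).
  suff Qy : Q (val y) by rewrite (Qy y hy).
  apply: (@linked_ind _ _ [set p | iset I p /\ q h p] Q _ (val x)).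
  - move=> a b [Ia ha] [Ib hb] ab Qa w hw wb; subst b.
    rewrite -(Qa (mkpoint Ia) ha erefl); case/orP: ab => [aw|wa].
      rewrite -(rcolim_inj_nat (x := mkpoint Ia) (y := w) aw).
      by rewrite -(tE _ _ aw (grid_le qG aw)) tC.
    rewrite -(rcolim_inj_nat (x := w) (y := mkpoint Ia) wa).
    by rewrite -(tE _ _ wa (grid_le qG wa)) tC.
  - by split; [exact: ipointP|].
  - by apply: (grid_up qG Iz) => //; apply: ipointP.
  - move=> w hw /val_inj wx; subst w.
    by congr (rcolim_inj (t _ _ _ _)); apply: Prop_irrelevance.
have [|phi phiE] := @rcolim_desc k d P M I (rcolim M C)
    (fun x => (@rcolim_inj k d P M C (inc x) : {linear M (val (inc x)) -> rcolim M C})).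
  by move=> x y xy v; apply: (rcolim_inj_nat (x := inc x) (y := inc y) xy).
have above (h : ipoint C) : exists x : ipoint I, q (val h) (val x).
  by have [_ [z [_ Iz _ hz]]] := ipointP h; exists (mkpoint Iz).
have below (h : ipoint C) : exists x : ipoint I, q (val x) (val h).
  by have [x [_ [Ix _ xh _]]] := ipointP h; exists (mkpoint Ix).
have [a aP] := choice above; have [b bP] := choice below.
have [|psi psiE] := @rcolim_desc k d P M C (rcolim M I)
    (fun h => (@rcolim_inj k d P M I (a h) : {linear _ -> _}) \o t _ _ (aP h)).
  move=> h h' hh' v /=; rewrite -(tE _ _ _ (grid_le qG hh')).
  have qa : q (val h) (val (a h')) by apply: (grid_trans qG _ (aP h')); apply: (grid_le qG).
  rewrite (tC _ _ _ _ _ qa); apply: (up _ (val (b h))) => //; exact: ipointP.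
(* The point that [psi] chooses above a point of [I] may be another one; [up] compares it with the
   point itself. *)
have psi_phi (v : rcolim M I) : range (@canonical_map k d P M I) v -> psi (phi v) = v.
  move=> [s _ <-]; rewrite /canonical_map phiE psiE /=.
  set x := base_point I; set v' := rlim_proj x s.
  have := up (val x) (val x) (a (inc x)) x (aP (inc x)) (gridxx qG _) v' (ipointP x)
    (gridxx qG _).
  by move=> ->; rewrite (tE _ _ (lexx _)) rmap_id.
have [n In] := pfd_canonical_has_dim I fM.
rewrite (grank_has_dim In); apply/esym/grank_has_dim.
have -> : range (@canonical_map k d P M C) = phi @` range (@canonical_map k d P M I).
  apply/seteqP; split=> [_ [s _ <-]|_ [_ [s _ <-] <-]].
    have [|s' s'E] := @rlim_mk k d P M I (fun x => rlim_proj (inc x) s).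
      by move=> x y xy; apply: (rlim_proj_nat (x := inc x) (y := inc y)).
    exists (canonical_map s'); first by exists s'.
    by rewrite (canonical_mapE (inc (base_point I)) s) /canonical_map phiE s'E.
  (* The family [s] extends to the hull by carrying it to [h] from the chosen point [b h] below;
     compatibility is [down]. *)
  have [|s' s'E] := @rlim_mk k d P M C (fun h => t _ _ (bP h) (rlim_proj (b h) s)).
    move=> h h' hh'; rewrite -(tE _ _ _ (grid_le qG hh')).
    have qb : q (val (b h)) (val h') by apply: (grid_trans qG (bP h)); apply: (grid_le qG).
    rewrite (tC _ _ _ _ _ qb); apply: (down s _ (val (a h'))) => //; exact: ipointP.
  exists s' => //; rewrite (canonical_mapE (inc (base_point I))) s'E.
  rewrite /canonical_map phiE; congr rcolim_inj.
  set x := base_point I.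
  have := down s (val x) (val x) (b (inc x)) x (bP (inc x)) (gridxx qG _) (ipointP x)
    (gridxx qG _).
  by move=> e; apply: (etrans e); rewrite (tE _ _ (lexx _)) rmap_id.
apply: has_dim_image In; first exact: range_submod.
by move=> u /psi_phi {2}<- ->; rewrite linear0.
Qed.

Lemma tame_diagram : exists (L : seq (pinterval P)) (dg : pinterval P -> int),
  [/\ uniq L, forall J, J \in L -> fpresentable (krep k J),
      forall J, J \notin L -> dg J = 0 &
      forall I, grank M I = \sum_(J <- L | `[< iset I `<=` iset J >]) dg J].
Proof.
have [L0 L0P] := closed_intervals qG.
(* Inverting only over supported closed intervals keeps the coefficients on intervals whose
   representation is tame, hence finitely presentable. *)
pose good J := grid_closed q J /\ forall x, iset J x -> supported G x.
pose L := undup [seq J <- L0 | `[< good J >]].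
have LP J : (J \in L) = `[< good J >].
  rewrite mem_undup mem_filter; case: asboolP => //= -[cJ _]; exact: L0P.
have uL : uniq L by exact: undup_uniq.
have [|||dg [dg0 dgP]] := @moebius_exists _ (fun I J : pinterval P => iset I `<=` iset J)
    _ _ _ L (grank M) uL.
- by move=> I x.
- by move=> y x z xy yz; apply: subset_trans yz.
- by move=> x y xy yx; apply: pinterval_eq; apply/seteqP.
exists L, dg; split=> // [J|I].
  rewrite LP => /asboolP[cJ sJ]; apply: (tame_fp qG); last exact: pfd_mx.
  apply: (tame_krep _ qG) => // x y xy yx Jx; exact: (cJ x x).
have subE J : J \in L -> `[< iset I `<=` iset J >] = `[< iset (hull qG I) `<=` iset J >].
  rewrite LP => /asboolP[cJ _]; apply/asboolP/asboolP; first exact: hull_sub.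
  by apply: subset_trans; apply: (sub_hull qG).
rewrite grank_hull.
have -> : \sum_(J <- L | `[< iset I `<=` iset J >]) dg J =
    \sum_(J <- L | `[< iset (hull qG I) `<=` iset J >]) dg J.
  rewrite big_seq_cond [RHS]big_seq_cond; apply: eq_bigl => J.
  by case JL: (J \in L) => //=; apply: subE.
have [gI|nI] := pselect (good (hull qG I)); first by rewrite dgP// LP; apply/asboolP.
(* A hull is always closed, so if it is not good it contains an unsupported point. Then the rank is
   0 and no interval of [L] contains the hull, so the sum is empty. *)
have [x Hx xs] : exists2 x, iset (hull qG I) x & ~ supported G x.
  apply: contrapT => h; apply: nI; split; first exact: hull_closed.
  by move=> x Hx; apply: contrapT => xs; apply: h; exists x.
rewrite (grank_eq0 Hx (tM.1 x xs)) big_seq_cond big1// => J /andP[].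
rewrite LP => /asboolP[_ sJ] /asboolP HJ.
by case: xs; apply/sJ/HJ.
Qed.

End Extension.

(** * Grids on chains, planes and finite posets *)

Definition has_grids (d : Order.disp_t) (P : porderType d) :=
  forall S : seq P, exists (q : rel P) (G : seq P), is_grid q G /\ {subset S <= G}.

Lemma fp_diagram (k : fieldType) (d : Order.disp_t) (P : porderType d) (M : rep k P) :
  has_grids P -> fpresentable M ->
  exists (L : seq (pinterval P)) (dg : pinterval P -> int),
  [/\ uniq L, forall J, J \in L -> fpresentable (krep k J),
      forall J, J \notin L -> dg J = 0 &
      forall I, grank M I = \sum_(J <- L | `[< iset I `<=` iset J >]) dg J].
Proof.
move=> gP fpM; have fM := fp_pfd fpM.
case: fpM => s [t [f [g /is_cokernelP fg]]].
have [q [G [qG stG]]] := gP (s ++ t).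
apply: (tame_diagram qG _ fM); apply: (tame_exact_pair fg);
  by apply: (tame_free _ qG) => x xs; apply: stG; rewrite mem_cat xs ?orbT.
Qed.

Lemma finite_has_grids (d : Order.disp_t) (P : finPOrderType d) : has_grids P.
Proof.
move=> S; exists <=%O, (enum P); split; last by move=> x _; rewrite mem_enum.
have mid (I : pinterval P) x h z : iset I x -> iset I z -> (x <= h)%O -> (h <= z)%O -> iset I h.
  by have [_ _ cI] := pintervalP I; apply: cI.
split=> [//|y x z|//|g x _ _|x h xh|I h z x y Iz hz Ix Iy xh yh|I h z x y Iz zh Ix Iy hx hy|].
- exact: le_trans.
- by exists x; rewrite ?mem_enum// lexx.
- by exists x.
(* Here [h] lies between [x] and [z], so it belongs to [I] by convexity and is itself the link
   between [x] and [y]. *)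
- have Ih := mid _ _ _ _ Ix Iz xh hz.
  apply: (@linked_trans _ _ _ _ h); apply: linked1 => //; rewrite /Order.comparable ?xh ?yh ?orbT//.
- have Ih := mid _ _ _ _ Iz Ix zh hx.
  apply: (@linked_trans _ _ _ _ h); apply: linked1 => //; rewrite /Order.comparable ?hx ?hy ?orbT//.
- by exists P, id => x y ->.
Qed.

(** * Grids on a chain *)

Section Chain.
Variables (d : Order.disp_t) (T : orderType d).
Implicit Types (S : seq T) (x y h : T).

Definition chainq S : rel T := fun x y => all (fun a => (a <= x)%O ==> (a <= y)%O) S.

Lemma chainqP S x y : reflect (forall a, a \in S -> (a <= x)%O -> (a <= y)%O) (chainq S x y).
Proof.
apply: (iffP allP) => [h a aS ax|h a aS]; first exact: (implyP (h a aS)).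
by apply/implyP; apply: h.
Qed.

Lemma chainq_le S x y : (x <= y)%O -> chainq S x y.
Proof. by move=> xy; apply/chainqP => a _ /le_trans; apply. Qed.

Lemma chainq_trans S y x z : chainq S x y -> chainq S y z -> chainq S x z.
Proof. by move=> /chainqP xy /chainqP yz; apply/chainqP => a aS /(xy a aS)/(yz a aS). Qed.

Lemma chainq_floor S g x : g \in S -> (g <= x)%O ->
  exists2 g', g' \in S & (g' <= x)%O && chainq S x g'.
Proof.
move=> gS gx.
(* For the reversed order, [minimal_in] produces the largest element of [S] below [x]; the given [g]
   makes the list nonempty. *)
have tr (b a c : T) : (b <= a)%O -> (c <= b)%O -> (c <= a)%O.
  by move=> ba cb; apply: le_trans ba.
have anti (a b : T) : (b <= a)%O -> (a <= b)%O -> a = b.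
  by move=> ba ab; apply/le_anti; rewrite ab ba.
have [m] := minimal_in tr anti g [seq a <- S | (a <= x)%O].
have memE (a : T) : a \in g :: [seq a <- S | (a <= x)%O] = (a <= x)%O && (a \in S).
  by rewrite inE mem_filter; case: eqP => //= ->; rewrite gS gx.
rewrite memE => /andP[mx mS] mP; exists m; rewrite // mx; apply/chainqP => a aS ax.
case/orP: (le_total a m) => // ma.
by rewrite (mP a _ ma)// memE ax aS.
Qed.

(** With [chainq_max], this keeps the rectangle spanned by two points of the plane on the same side
    of [h] as these points. *)
Lemma chainq_min S h x y : chainq S h x -> chainq S h y -> chainq S h (Order.min x y).
Proof.
by move=> /chainqP hx /chainqP hy; apply/chainqP => a aS ah; rewrite le_min hx ?hy.
Qed.

Lemma chainq_max S h x y : chainq S x h -> chainq S y h -> chainq S (Order.max x y) h.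
Proof.
move=> /chainqP xh /chainqP yh; apply/chainqP => a aS.
by rewrite le_max => /orP[/xh|/yh]; apply.
Qed.

Definition chain_sign S x : (size S).-tuple bool := map_tuple (fun a => (a <= x)%O) (in_tuple S).

Lemma chain_signP S x y : chain_sign S x = chain_sign S y -> chainq S x y.
Proof.
move=> /(congr1 val) /= /eq_in_map e; apply/chainqP => a /e /= ->//.
Qed.

Lemma chain_has_grids : has_grids T.
Proof.
move=> S; exists (chainq S), S; split=> //; split.
- exact: chainq_le.
- exact: chainq_trans.
- by move=> g y gS /chainqP; apply.
- exact: chainq_floor.
- move=> x h xh; exists (Order.min x h); rewrite !ge_min !lexx orbT; split=> //.
  by apply: chainq_min => //; apply: chainq_le.
- by move=> I h z x y Iz hz Ix Iy xh yh; apply: linked1 => //; apply: comparableT.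
- by move=> I h z x y Iz hz Ix Iy xh yh; apply: linked1 => //; apply: comparableT.
- by exists _, (chain_sign S) => x y; apply: chain_signP.
Qed.

End Chain.

(** * Grids on a product of two chains *)

Section Plane.
Variables (d1 d2 : Order.disp_t) (T1 : orderType d1) (T2 : orderType d2).
Local Notation P := (T1 *p T2)%type.
Implicit Types (x y p r w : P) (I : pinterval P).

(* Retracting the plane onto the rectangle with corners [p] and [r] maps an
   interval containing [p] and [r] into itself, so it moves any path from [p]
   to [r] in the interval into the rectangle. *)
Definition clip p r w : P :=
  (Order.max p.1 (Order.min w.1 r.1), Order.max r.2 (Order.min w.2 p.2)).

(** Here [p] is the upper left and [r] the lower right corner. In each position of [w], the clipped
    point lies between two of [p], [r], [w], possibly equal ones, and convexity applies. *)
Lemma clip_interval I p r w : iset I p -> iset I r -> iset I w ->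
  (p.1 <= r.1)%O -> (r.2 <= p.2)%O -> iset I (clip p r w).
Proof.
have [_ _ cI] := pintervalP I; move=> Ip Ir Iw pr rp.
have btw x y z : iset I x -> iset I z -> [&& (x.1 <= y.1)%O, (x.2 <= y.2)%O,
    (y.1 <= z.1)%O & (y.2 <= z.2)%O] -> iset I y.
  move=> Ix Iz /and4P[h1 h2 h3 h4]; apply: (cI x y z) => //; rewrite leEprod.
    by rewrite h1.
  by rewrite h3.
rewrite /clip; have [w1p|pw1] := orP (le_total w.1 p.1).
  rewrite (min_l (le_trans w1p pr)) (max_l w1p).
  have [w2p|pw2] := orP (le_total w.2 p.2).
    rewrite (min_l w2p); apply: (btw w _ p) => //=.
    by rewrite w1p le_max !lexx orbT ge_max rp w2p.
  by rewrite (min_r pw2) (max_r rp); apply: (btw p _ p) => //=; rewrite !lexx.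
have [w2p|pw2] := orP (le_total w.2 p.2); last first.
  rewrite (min_r pw2) (max_r rp); apply: (btw p _ w) => //=.
  by rewrite le_max !lexx /= ge_max pw1 ge_min lexx.
rewrite (min_l w2p); have [r1w|wr1] := orP (le_total r.1 w.1).
  rewrite (min_r r1w) (max_r pr); have [r2w|wr2] := orP (le_total r.2 w.2).
    by rewrite (max_r r2w); apply: (btw r _ w) => //=; rewrite !lexx r2w r1w.
  by rewrite (max_l wr2); apply: (btw r _ r) => //=; rewrite !lexx.
rewrite (min_l wr1) (max_r pw1); have [r2w|wr2] := orP (le_total r.2 w.2).
  by rewrite (max_r r2w); apply: (btw w _ w) => //=; rewrite !lexx.
by rewrite (max_l wr2); apply: (btw w _ r) => //=; rewrite !lexx wr1 wr2.
Qed.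

Lemma clip_mono p r : {homo clip p r : x y / (x <= y)%O}.
Proof.
move=> x y; rewrite !leEprod /= => /andP[xy1 xy2]; apply/andP; split.
  by apply: le_max2 => //; apply: le_min2.
by apply: le_max2 => //; apply: le_min2.
Qed.

Definition in_rect p r : set P := [set w |
  [/\ (Order.min p.1 r.1 <= w.1)%O, (Order.min p.2 r.2 <= w.2)%O,
      (w.1 <= Order.max p.1 r.1)%O & (w.2 <= Order.max p.2 r.2)%O]].

Lemma plane_linked I p r : iset I p -> iset I r ->
  linked [set w | iset I w /\ in_rect p r w] p r.
Proof.
have corner I' p' r' : iset I' p' -> iset I' r' -> (p'.1 <= r'.1)%O -> (r'.2 <= p'.2)%O ->
    linked [set w | iset I' w /\ in_rect p' r' w] p' r'.
  move=> Ip Ir pr rp; set A := [set w | _].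
  have Ac w : iset I' w -> A (clip p' r' w).
    move=> Iw; split; first exact: clip_interval.
    rewrite /in_rect /= (min_l pr) (min_r rp) (max_r pr) (max_l rp).
    by rewrite !le_max !lexx !ge_max pr rp !ge_min !lexx !orbT.
  have cp : clip p' r' p' = p'.
    by rewrite /clip (min_l pr) (min_l (lexx _)) !max_r//; case: (p').
  have cr : clip p' r' r' = r'.
    by rewrite /clip (min_r (lexx _)) (min_l rp) (max_r pr) (max_l (lexx _)); case: (r').
  rewrite -[X in linked _ _ X]cr.
  apply: (@linked_ind _ _ (iset I') (fun w => linked A p' (clip p' r' w)) _ p' r') => //.
  - move=> x y Ix Iy xy lx; apply: linked_trans lx _; apply: linked1; first exact: Ac.
    by case/orP: xy => xy; rewrite /Order.comparable (clip_mono _ _ xy) ?orbT.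
  - exact: interval_linked.
  - by rewrite cp; apply: linked_refl.
move=> Ip Ir.
have rectr : in_rect p r r by rewrite /in_rect /= !ge_min !le_max !lexx !orbT.
have [/orP[]pr1 /orP[]pr2] := (le_total p.1 r.1, le_total p.2 r.2).
- by apply: linked1; rewrite // /Order.comparable !leEprod pr1 pr2.
- exact: corner.
- have rectE : in_rect p r = in_rect r p.
    by rewrite /in_rect /= ![Order.min p.1 _]minC ![Order.max p.1 _]maxC
      ![Order.min p.2 _]minC ![Order.max p.2 _]maxC.
  rewrite rectE; apply: linked_sym; first by split=> //; rewrite -rectE.
  exact: corner.
- by apply: linked1; rewrite // /Order.comparable !leEprod pr1 pr2 orbT.
Qed.

Lemma plane_has_grids : has_grids P.
Proof.
move=> S; pose A := map fst S; pose B := map snd S.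
pose q : rel P := fun x y => chainq A x.1 y.1 && chainq B x.2 y.2.
(* The full product of the coordinates is taken, not just [S]: the floor of a point is computed in
   each coordinate separately and must be a grid point. *)
exists q, [seq (a, b) | a <- A, b <- B]; split; last first.
  move=> [a b] abS; apply/allpairsP; exists (a, b); split=> //=.
    by apply/mapP; exists (a, b).
  by apply/mapP; exists (a, b).
split.
- by move=> x y; rewrite leEprod => /andP[xy1 xy2]; rewrite /q !chainq_le.
- move=> y x z /andP[xy1 xy2] /andP[yz1 yz2]; rewrite /q.
  by rewrite (chainq_trans xy1) ?(chainq_trans xy2).
- move=> _ y /allpairsP[[a b] [/= aA bB ->]] /andP[/chainqP h1 /chainqP h2].
  by rewrite leEprod /= h1 ?h2.
- move=> _ x /allpairsP[[a b] [/= aA bB ->]]; rewrite leEprod /= => /andP[ax bx].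
  have [a' aA' /andP[ax' xa']] := chainq_floor aA ax.
  have [b' bB' /andP[bx' xb']] := chainq_floor bB bx.
  exists (a', b'); first by apply/allpairsP; exists (a', b').
  by rewrite leEprod /= ax' bx' /q /= xa' xb'.
- move=> x h /andP[xh1 xh2]; exists (Order.min x.1 h.1, Order.min x.2 h.2).
  rewrite !leEprod /= !ge_min !lexx !orbT; split=> //.
  by rewrite /q /= !chainq_min// chainq_le.
- move=> I h z x y Iz hz Ix Iy /andP[xh1 xh2] /andP[yh1 yh2].
  (* The rectangle lies below the join of [x] and [y], which is still below [h] for [q]. *)
  apply: linked_sub (plane_linked Ix Iy) => w [Iw [_ _ w1 w2]]; split=> //.
  rewrite /q (chainq_trans (chainq_le A w1)) ?(chainq_trans (chainq_le B w2))//.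
    exact: chainq_max.
  exact: chainq_max.
- move=> I h z x y Iz zh Ix Iy /andP[hx1 hx2] /andP[hy1 hy2].
  apply: linked_sub (plane_linked Ix Iy) => w [Iw [w1 w2 _ _]]; split=> //.
  apply/andP; split.
    by apply: (chainq_trans _ (chainq_le A w1)); apply: chainq_min.
  by apply: (chainq_trans _ (chainq_le B w2)); apply: chainq_min.
- exists _, (fun x : P => (chain_sign A x.1, chain_sign B x.2)) => x y [e1 e2].
  by apply/andP; split; apply: chain_signP; apply: val_inj.
Qed.

End Plane.

Lemma line_plane_or_finite_has_grids (R : realType) (d : Order.disp_t) (P : porderType d) :
  line_plane_or_finite R P -> has_grids P.
Proof.
case=> [||d' Q]; [exact: chain_has_grids|exact: plane_has_grids|exact: finite_has_grids].
Qed.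

(** * The split Grothendieck group *)

Section GrothendieckGroup.
Variables (k : fieldType) (d : Order.disp_t) (P : porderType d).
Implicit Types (M N S : fprep k P) (c : isoclass k P).

Local Notation rels := (split_relations (k := k) (P := P)).
Local Notation pi_K0 D := (\pi_{ideal_quot (zspan rels)} D : K0sp k P).

Lemma pi_K0_eq (D E : {freeg (isoclass k P)}) : pi_K0 D = pi_K0 E <-> D - E \in zspan rels.
Proof. by rewrite Quotient.idealrBE; split=> [/eqP|/eqP]. Qed.

Lemma pi_K0B (D E : {freeg (isoclass k P)}) : pi_K0 (D - E) = pi_K0 D - pi_K0 E.
Proof. exact: (raddfB (\pi_{ideal_quot (zspan rels)})). Qed.

Lemma zspan_incl (V : zmodType) (A : set V) a : A a -> a \in zspan A.
Proof. by move=> Aa; apply/asboolP => Z _; apply. Qed.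

Lemma zspan_ind (V : zmodType) (A : set V) (Q : V -> Prop) :
  Q 0 -> (forall u v, Q u -> Q v -> Q (u - v)) -> (forall a, A a -> Q a) ->
  forall v, v \in zspan A -> Q v.
Proof.
move=> Q0 QB QA v /asboolP /(_ (fun v => `[< Q v >])) h.
apply/asboolP; apply: h; last by move=> a /QA Qa; apply/asboolP.
split; first exact/asboolP.
by move=> u w /asboolP Qu /asboolP Qw; apply/asboolP; apply: QB.
Qed.

Lemma in_isoclass_ex M : exists c, in_isoclass M c.
Proof.
have fpM := fp_repP M; have [m mM] := mx_model (fp_pfd fpM).
have fpm := fp_iso (isomorphic_sym mM) fpM.
by eexists; exists (FPMx fpm).
Qed.

Lemma in_isoclass_iso (M N : rep k P) c :
  isomorphic M N -> in_isoclass M c -> in_isoclass N c.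
Proof. by move=> MN [m [mM ->]]; exists m; split=> //; apply: isomorphic_trans MN. Qed.

Lemma in_isoclass_uniq (M : rep k P) c c' : in_isoclass M c -> in_isoclass M c' -> c = c'.
Proof.
move=> [m [mM ->]] [n [nM ->]]; apply/eqquotP/asboolP.
exact: isomorphic_trans mM (isomorphic_sym nM).
Qed.

Definition class_rep c : fprep k P := rep_of_fpmx (repr c).

Lemma in_isoclass_rep c : in_isoclass (class_rep c) c.
Proof. by exists (repr c); split; [exact: isomorphic_refl|apply/esym; exact: reprK]. Qed.

Lemma in_isoclassE (M : rep k P) c : in_isoclass M c -> isomorphic (class_rep c) M.
Proof.
move=> [m [mM ->]]; apply: isomorphic_trans mM.
by apply/asboolP; rewrite -[X in is_true X]/(fpmx_iso _ _); apply/eqquotP; exact: reprK.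
Qed.

Lemma K0classE M c : in_isoclass M c -> K0class M = pi_K0 << c >>.
Proof.
move=> Mc; apply: xget_unique; first by exists c.
by move=> _ [c' Mc' ->]; rewrite (in_isoclass_uniq Mc Mc').
Qed.

Lemma K0classD M N S : isomorphic S (radd M N) -> K0class S = K0class M + K0class N.
Proof.
move=> SMN; have [cM hM] := in_isoclass_ex M; have [cN hN] := in_isoclass_ex N.
have [cS hS] := in_isoclass_ex S.
rewrite (K0classE hM) (K0classE hN) (K0classE hS) -[RHS](raddfD (\pi_{ideal_quot (zspan rels)})).
apply/pi_K0_eq/zspan_incl; exists M, N, cM, cN, cS; split=> //.
exact: in_isoclass_iso hS.
Qed.

Definition fp_sum M N : fprep k P := FPRep (fp_radd (fp_repP M) (fp_repP N)).
Definition fp_zero : fprep k P := FPRep (fp_rzero k P).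

Lemma K0class_sum M N : K0class (fp_sum M N) = K0class M + K0class N.
Proof. by apply: K0classD; apply: isomorphic_refl. Qed.

(** Differences of classes are closed under subtraction, because a sum of classes is the class of a
    direct sum. This makes [K0ext] meaningful at every element. *)
Lemma K0sp_difference (x : K0sp k P) : exists M N, x = K0class M - K0class N.
Proof.
have : x \in zspan [set z | exists M, z = K0class M].
  rewrite -[x]reprK; set D := repr x.
  rewrite -(freeg_sumE D) (raddf_sum (\pi_{ideal_quot (zspan rels)})).
  apply: rpred_sum => c _; rewrite -[coeff c D]intz -freegU_mulz raddfMz rpredMz//.
  by apply: zspan_incl; exists (class_rep c); apply/esym/K0classE/in_isoclass_rep.
apply: (zspan_ind (Q := fun x => exists M N, x = K0class M - K0class N)) => [|_ _ [M [N ->]] [M' [N' ->]]|_ [M ->]].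
- by exists fp_zero, fp_zero; rewrite subrr.
- exists (fp_sum M N'), (fp_sum N M'); rewrite !K0class_sum.
  by rewrite opprB opprD [RHS]addrACA.
- exists M, fp_zero; suff -> : K0class fp_zero = 0 by rewrite subr0.
  (* The zero representation is isomorphic to its sum with itself, so its class is idempotent for
     addition, hence 0. *)
  apply: (@addrI _ (K0class fp_zero)); rewrite addr0; apply/esym.
  exact/K0classD/isomorphic_rzero_radd.
Qed.

Section Extension.
Variables (A : zmodType) (h : fprep k P -> A).
Hypothesis h_iso : forall M N, isomorphic M N -> h M = h N.
Hypothesis h_add : forall M N S, isomorphic S (radd M N) -> h S = h M + h N.

Lemma K0sp_desc : exists H : {additive K0sp k P -> A}, forall M, H (K0class M) = h M.
Proof.
(* [zmodule A] is [A] viewed as a module over the integers, the kind of codomain that [fglift]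
   takes. *)
pose g c : zmodule A := h (class_rep c).
pose F : {additive {freeg (isoclass k P)} -> zmodule A} :=
  HB.pack (fglift g) (GRing.isZmodMorphism.Build _ _ (fglift g) (lift_is_additive g)).
have FE c : F << c >> = h (class_rep c) by rewrite /F /= liftU scale1r.
have F0 D : D \in zspan rels -> F D = 0.
  apply: (zspan_ind (Q := fun D => F D = 0)) => [|u v Fu Fv|_ [M [N [cM [cN [cS [hM hN hS ->]]]]]]].
  - exact: raddf0.
  - by rewrite raddfB Fu Fv subrr.
  - rewrite raddfB raddfD !FE (h_iso (in_isoclassE hM)) (h_iso (in_isoclassE hN)).
    by rewrite (h_add (in_isoclassE hS)) subrr.
pose H (x : K0sp k P) : A := F (repr x).
have HE D : H (pi_K0 D) = F D.
  apply/eqP; rewrite -subr_eq0 -raddfB; apply/eqP/F0/pi_K0_eq; exact: reprK.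
have Hadd : zmod_morphism H.
  by move=> x y; rewrite -[x]reprK -[y]reprK -pi_K0B !HE raddfB.
pose H' : {additive K0sp k P -> A} := HB.pack H (GRing.isZmodMorphism.Build _ _ H Hadd).
exists H' => M; have [c Mc] := in_isoclass_ex M.
by rewrite (K0classE Mc) /H' /= HE FE; apply/h_iso/in_isoclassE.
Qed.

Lemma K0extE : exists H : {additive K0sp k P -> A},
  K0ext h =1 H /\ forall M, H (K0class M) = h M.
Proof.
have [H HE] := K0sp_desc; exists H; split=> // x.
apply: xget_unique.
  by have [M [N ->]] := K0sp_difference x; exists M, N; rewrite raddfB !HE.
by move=> _ [M [N [-> ->]]]; rewrite raddfB !HE.
Qed.

End Extension.

End GrothendieckGroup.

(** * Diagrams *)

Lemma fct_mulrz (T : Type) (V : zmodType) (g : T -> V) (n : int) x : (g *~ n) x = g x *~ n.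
Proof.
have nat_case m : (g *+ m) x = g x *+ m.
  by elim: m => [//|m IHm]; rewrite mulrS [LHS]/(g x + (g *+ m) x) IHm mulrS.
by case: n => m; [apply: nat_case|rewrite NegzE !mulrNz [LHS]/(- (g *+ _) x) nat_case].
Qed.

Section Diagrams.
Variables (d : Order.disp_t) (P : porderType d).
Implicit Types (I J : pinterval P) (r g : pinterval P -> int).

Lemma fsum_supersets (L : seq (pinterval P)) g I : uniq L ->
  (forall J, J \notin L -> g J = 0) ->
  \sum_(J \in [set J : pinterval P | iset I `<=` iset J]) g J =
  \sum_(J <- L | `[< iset I `<=` iset J >]) g J.
Proof.
move=> uL gL; rewrite fsbig_mkcond (fsbigE L)//; last first.
  by move=> J _ /gL; rewrite /patch => ->; rewrite if_same.
rewrite [RHS]big_mkcond /=; apply: eq_big => [J|J _]; first by rewrite in_setT.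
by rewrite /patch; congr (if _ then _ else _); apply/idP/asboolP; rewrite inE.
Qed.

Lemma is_diagram_list (L : seq (pinterval P)) r g : uniq L ->
  (forall J, J \notin L -> g J = 0) ->
  (forall I, r I = \sum_(J <- L | `[< iset I `<=` iset J >]) g J) -> is_diagram r g.
Proof.
move=> uL gL rE I; rewrite (fsum_supersets _ uL gL) rE; split=> //.
have gP J : g J != 0 -> J \in L by apply: contraNT => /gL ->.
by apply: (sub_finite_set _ (finite_seq L)) => J [_ /gP].
Qed.

(** If [g] and [g'] differ at [I], they differ at finitely many intervals above it. At a maximal
    such [m], the equations for [m] have equal terms except the one at [m], a contradiction. *)
Lemma is_diagram_uniq r g g' : is_diagram r g -> is_diagram r g' -> g = g'.
Proof.
move=> rg rg'; apply/funext => I; apply: contrapT => gI.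
have [f1 _] := rg I; have [f2 _] := rg' I.
have : finite_set ([set J : pinterval P | iset I `<=` iset J /\ g J != 0] `|`
    [set J : pinterval P | iset I `<=` iset J /\ g' J != 0]) by rewrite finite_setU.
move=> /finite_seqP[s sE].
have sP J : iset I `<=` iset J -> g J <> g' J -> J \in [seq J <- s | g J != g' J].
  move=> IJ /eqP gJ; rewrite mem_filter gJ /=.
  have : [set` s] J; last by [].
  rewrite -sE; have [g0|] := eqVneq (g J) 0; last by left.
  by right; split=> //; rewrite -g0 eq_sym.
(* Inclusion is reversed, so that a minimal element is a maximal interval. *)
have [||m mI mP] := @minimal_in _ (fun K J : pinterval P => iset J `<=` iset K) _ _
    I [seq J <- s | g J != g' J].
- by move=> y x z xy yz; apply: subset_trans yz xy.
- by move=> x y xy yx; apply: pinterval_eq; apply/seteqP.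
have [Im gm] : iset I `<=` iset m /\ g m <> g' m.
  move: mI; rewrite inE => /predU1P[->|]; first by split.
  rewrite mem_filter => /andP[/eqP gm ms]; split=> //.
  by have : [set` s] m by []; rewrite -sE => -[[]|[]].
pose A := [set J : pinterval P | iset m `<=` iset J].
have out J : A J -> J \notin s -> g J = 0 /\ g' J = 0.
  move=> mJ Js; have IJ := subset_trans Im mJ.
  suff : ~ (g J != 0 \/ g' J != 0) by case/not_orP => /negP/negPn/eqP -> /negP/negPn/eqP ->.
  move=> h; move/negP: Js; apply; have : [set` s] J; last by [].
  by rewrite -sE; case: h => ?; [left|right].
have mA : (A `&` [set` s]) m.
  split=> //; apply: contrapT => /negP /(out m (@subset_refl _ _))[e e'].
  by apply: gm; rewrite e e'.
have finA : finite_set (A `&` [set` s]) by apply: sub_finite_set (finite_seq s) => J [].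
have [_ sg] := rg m; have [_ sg'] := rg' m; apply: gm.
have red (h : pinterval P -> int) : (forall J, A J -> J \notin s -> h J = 0) ->
    \sum_(J \in A) h J = h m + \sum_(J \in (A `&` [set` s]) `\ m) h J.
  move=> h0; rewrite -(fsbigD1 m _ _ finA mA); apply/esym/fsbig_widen; first by move=> J [].
  move=> J [AJ AsJ]; apply: (h0 J AJ); apply/negP => Js; exact: AsJ.
move: sg; rewrite sg' -/A red => [|J AJ Js]; last by have [] := out J AJ Js.
rewrite red => [|J AJ Js]; last by have [] := out J AJ Js.
suff -> : \sum_(J \in (A `&` [set` s]) `\ m) g J = \sum_(J \in (A `&` [set` s]) `\ m) g' J.
  by move=> /addIr ->.
apply: eq_fsbigr => J; rewrite inE => -[[mJ _] Jm]; apply: contrapT => gJ; apply: Jm.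
by apply: mP => //; rewrite inE sP ?orbT//; apply: subset_trans mJ.
Qed.

End Diagrams.

(** * Characterization of the diagram homomorphism *)

Section Characterization.
Variables (k : fieldType) (d : Order.disp_t) (P : porderType d).
Implicit Types (M N S : fprep k P) (I J : pinterval P) (L : seq (fpinterval k P)).

Lemma fp_interval_inj : injective (@fp_interval k d P).
Proof.
by case=> [I hI] [J hJ] /= IJ; subst J; congr FPInterval; apply: Prop_irrelevance.
Qed.

Lemma grank_fp_iso M N : isomorphic M N -> grank M = grank N.
Proof. by move=> MN; apply/funext => I; apply: grank_iso => //; apply/fp_pfd/fp_repP. Qed.

Lemma grank_fp_add M N S : isomorphic S (radd M N) -> grank S = grank M + grank N.
Proof.
have [fM fN] := (fp_pfd (fp_repP M), fp_pfd (fp_repP N)).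
move=> SMN; apply/funext => I; rewrite (grank_iso I _ SMN) ?grank_radd//.
exact: pfd_iso (isomorphic_sym SMN) (pfd_radd fM fN).
Qed.

Definition spans_diagram (g : pinterval P -> int) L :=
  uniq L /\ forall J, J \notin map (@fp_interval k d P) L -> g J = 0.

Lemma spans_diagramU g g' L L' : spans_diagram g L -> spans_diagram g' L' ->
  exists L'', spans_diagram g L'' /\ spans_diagram g' L''.
Proof.
move=> [_ gL] [_ gL']; exists (undup (L ++ L')).
have mE J : J \notin map (@fp_interval k d P) (undup (L ++ L')) ->
    J \notin map (@fp_interval k d P) L /\ J \notin map (@fp_interval k d P) L'.
  move=> h; split; apply: contra h => /mapP[K KL ->]; apply: map_f;
  by rewrite mem_undup mem_cat KL ?orbT.
split; split; rewrite ?undup_uniq// => J /mE[].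
  by move=> /gL.
by move=> _ /gL'.
Qed.

Lemma diagram_sumE (M : rep k P) L : spans_diagram (diagram M) L ->
  diagram_sum M = \sum_(J <- L) K0class (fp_krep J) *~ diagram M J.
Proof.
move=> [uL gL]; rewrite /diagram_sum (fsbigE L)//; last first.
  by move=> J _ JL; rewrite gL ?mulr0z// mem_map//; exact: fp_interval_inj.
by apply: eq_bigl => J; rewrite in_setT.
Qed.

Lemma diagram_eq (M N : rep k P) : grank M = grank N -> diagram M = diagram N.
Proof. by rewrite /diagram => ->. Qed.

Lemma diagramE (M : rep k P) g : is_diagram (grank M) g -> diagram M = g.
Proof.
move=> Mg; apply: xget_unique; first by split=> // g'; apply: is_diagram_uniq.
by move=> g' [Mg' _]; apply: is_diagram_uniq Mg.
Qed.

Lemma diagram_krep (J : fpinterval k P) :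
  is_diagram (grank (krep k J)) (fun K => (K == fp_interval J)%:R).
Proof.
apply: (@is_diagram_list _ _ [:: fp_interval J]) => // [K|I].
  by rewrite inE => /negbTE ->.
rewrite big_cons big_nil eqxx; case: asboolP => [IJ|nIJ].
  by rewrite addr0; apply: grank_krep_sub.
exact: grank_krep_nsub.
Qed.

Lemma dgm_rep_krep (J : fpinterval k P) : val (dgm_rep (krep k J)) = K0class (fp_krep J).
Proof.
have JE := diagramE (diagram_krep J); rewrite /= (@diagram_sumE _ [:: J]).
  by rewrite big_seq1 JE eqxx mulr1z.
by split=> // K; rewrite JE inE => /negbTE ->.
Qed.

Hypothesis gP : has_grids P.

Lemma diagram_spec M :
  (exists L, spans_diagram (diagram M) L) /\ is_diagram (grank M) (diagram M).
Proof.
have [L [g [uL fL gL gE]]] := fp_diagram gP (fp_repP M).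
have Mg := is_diagram_list uL gL gE.
rewrite (diagramE Mg); split=> //.
have [L' LE] : exists L', map (@fp_interval k d P) L' = L.
  elim: L fL {uL gL gE Mg} => [_|J L IHL fL]; first by exists [::].
  have [|L' LE] := IHL; first by move=> K KL; apply: fL; rewrite inE KL orbT.
  by exists (FPInterval (fL J (mem_head _ _)) :: L'); rewrite /= LE.
exists L'.
by split; [apply: (@map_uniq _ _ (@fp_interval k d P)); rewrite LE|rewrite LE].
Qed.

Lemma spans_diagram_sum r g L I : is_diagram r g -> spans_diagram g L ->
  r I = \sum_(J <- L | `[< iset I `<=` iset J >]) g J.
Proof.
move=> rg [uL gL]; have [_ ->] := rg I.
rewrite (@fsum_supersets _ _ (map (@fp_interval k d P) L))// ?big_map//.
by rewrite map_inj_uniq//; exact: fp_interval_inj.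
Qed.

Lemma dgm_rep_iso M N : isomorphic M N -> dgm_rep M = dgm_rep N.
Proof.
by move=> /grank_fp_iso/diagram_eq MN; apply: val_inj; rewrite /= /diagram_sum MN.
Qed.

(** The sum of the two diagrams satisfies the defining equations for the sum of the ranks, so
    uniqueness makes it the diagram of [S]. *)
Lemma dgm_rep_add M N S : isomorphic S (radd M N) -> dgm_rep S = dgm_rep M + dgm_rep N.
Proof.
move=> /grank_fp_add SE; apply: val_inj; rewrite raddfD /=.
have [[LM sM] dM] := diagram_spec M; have [[LN sN] dN] := diagram_spec N.
have [L [{}sM {}sN]] := spans_diagramU sM sN.
have sS : spans_diagram (diagram M + diagram N) L.
  split=> [|J JL]; first by case: sM.
  by rewrite [LHS]/(diagram M J + diagram N J) (proj2 sM)// (proj2 sN).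
have dS : diagram S = diagram M + diagram N.
  apply: diagramE; rewrite SE.
  apply: (@is_diagram_list _ _ (map (@fp_interval k d P) L)); last 1 first.
  - move=> I; rewrite [LHS]/(grank M I + grank N I).
    rewrite (spans_diagram_sum _ dM sM) (spans_diagram_sum _ dN sN) [RHS]big_map.
    exact/esym/big_split.
  - by rewrite map_inj_uniq; [case: sM|exact: fp_interval_inj].
  - by case: sS.
rewrite (diagram_sumE sM) (diagram_sumE sN) (@diagram_sumE _ L) dS//.
rewrite -[RHS]big_split; apply: eq_bigr => J _ /=; exact: mulrzDr.
Qed.

Lemma dgmInt_characterization :
  [/\ zmod_morphism (@dgmInt k d P),
      invariant_ker (@dgmInt k d P) = invariant_ker (@rkInt k d P),
      (forall c : K0C k P, dgmInt (val c) = c) &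
      forall f : {additive K0sp k P -> K0C k P},
        invariant_ker f = invariant_ker (@rkInt k d P) ->
        (forall c : K0C k P, f (val c) = c) ->
        f =1 @dgmInt k d P].
Proof.
have [D [DE DK]] := K0extE dgm_rep_iso dgm_rep_add.
have [R [RE RK]] := K0extE (h := fun M : fprep k P => grank M) grank_fp_iso grank_fp_add.
have rk_krep (J : fpinterval k P) I : grank (krep k J) I = (`[< iset I `<=` iset J >])%:R.
  by case: asboolP => [/grank_krep_sub|/grank_krep_nsub] ->.
(* The rank of the combination of intervals given by a diagram is the defining sum of that diagram,
   since [rk_krep] is the indicator of inclusion. *)
have RD x : R (val (D x)) = R x.
  suff RDM M : R (val (D (K0class M))) = R (K0class M).
    by have [M [N ->]] := K0sp_difference x; rewrite !raddfB !RDM.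
  rewrite DK RK /=; have [[L sL] dM] := diagram_spec M.
  rewrite (diagram_sumE sL); apply/funext => I.
  rewrite raddf_sum (spans_diagram_sum _ dM sL) fct_sumE.
  rewrite [RHS]big_mkcond; apply: eq_bigr => J _.
  rewrite raddfMz RK.
  rewrite fct_mulrz [grank _ _]rk_krep; case: ifP => _; last by rewrite mul0rz.
  by rewrite -mulrzl mulr1 intz.
have valB (a b : K0C k P) : val (a - b) = val a - val b by exact: raddfB.
have Dval (c : K0C k P) : D (val c) = c.
  apply: val_inj; case: c => x /= Kx.
  apply: (zspan_ind (Q := fun x => val (D x) = x)) Kx => [|u v Du Dv|_ [J _ <-]].
  - by rewrite !raddf0.
  - by rewrite raddfB valB Du Dv.
  - by rewrite DK dgm_rep_krep.
have kerD x : D x = 0 <-> R x = 0.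
  split=> [Dx|]; first by rewrite -RD Dx !raddf0.
  (* If the rank vanishes on a difference of classes, the two representations have equal ranks and
     hence equal diagrams. *)
  have [M [N ->]] := K0sp_difference x; rewrite !raddfB !DK !RK => /eqP.
  rewrite subr_eq0 => /eqP /diagram_eq MN; apply/eqP; rewrite subr_eq0; apply/eqP.
  by apply: val_inj; rewrite /= /diagram_sum MN.
have kerE : invariant_ker (@dgmInt k d P) = invariant_ker (@rkInt k d P).
  by apply/seteqP; split=> x; rewrite /invariant_ker /= [dgmInt _]DE [rkInt _]RE => /kerD.
split=> [x y||c|f kerf fval x].
- by rewrite /dgmInt !DE raddfB.
- exact: kerE.
- by rewrite /dgmInt DE Dval.
(* As [D] is the identity on its image, [x] minus [D x] is in the kernel of [D], hence in that of
   [f]; and [f] fixes [D x]. *)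
- rewrite /dgmInt DE; apply/eqP; rewrite -subr_eq0 -[D x]fval -raddfB; apply/eqP.
  have : invariant_ker f (x - val (D x)); last by [].
  by rewrite kerf -kerE /invariant_ker /= [dgmInt _]DE raddfB Dval subrr.
Qed.

End Characterization.

Theorem theorem4p10 (R : realType) (k : fieldType) (d : Order.disp_t)
    (P : porderType d) (hP : line_plane_or_finite R P) :
  [/\ zmod_morphism (@dgmInt k d P),
      invariant_ker (@dgmInt k d P) = invariant_ker (@rkInt k d P),
      (forall c : K0C k P, dgmInt (val c) = c) &
      forall f : {additive K0sp k P -> K0C k P},
        invariant_ker f = invariant_ker (@rkInt k d P) ->
        (forall c : K0C k P, f (val c) = c) ->
        f =1 @dgmInt k d P].
Proof. exact: dgmInt_characterization (line_plane_or_finite_has_grids hP). Qed.
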